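(* Let $k$ be a field. The following hold. (i) For every integer $g\ge 13$ with $g\not\equiv 0 \pmod 3$, the numerical semigroup generated by $\{6,9,g,g+3\}$ is degree-special and has genus $g$. (ii) For every integer $g\ge 21$ with $g\equiv 0\pmod 3$, the numerical semigroup generated by $\{6,15,g-1,g+2\}$ is degree-special and has genus $g$. (iii) The numerical semigroup generated by $\{8,10,13,15\}$ is degree-special and has genus $15$.
   Context: A numerical semigroup is a subset $S\subset\mathbb{Z}_{\ge0}$ with finite complement, containing $0$ and closed under addition. Its genus is the number of positive integers not in $S$, and its multiplicity is its smallest nonzero element. The semigroup ring is $k[t^S]=k[t^s\mid s\in S]\subset k[t]$, graded by $\deg t^s=s$. Write $k[t^S]=P/I$ where $P$ is the polynomial ring over $k$ with one variable of degree $s_i$ for each minimal generator $s_i$ of $S$. Formal degree: for a homogeneous degree-0 map of graded free $P$-modules, written as a matrix with respect to homogeneous bases, where the source basis element of column $j$ has degree $c_j$ and the target basis element of row $i$ has degree $r_i$, the entry in position $(i,j)$ has formal degree $c_j-r_i$. (A nonzero entry is homogeneous of that degree; an entry of negative formal degree is zero.) Degree-special: $S$ is degree-special if the minimal graded $P$-free resolution of $P/I=k[t^S]$ has the form $$P\xleftarrow{\ \phi_1\ }P^6\xleftarrow{\ \phi_2\ }P^8\xleftarrow{\ \phi_3\ }P^3\leftarrow 0$$ (up to shifts of grading) and, possibly after reordering the generators of the free modules: (1) the last four entries of the first column of $\phi_3$ have negative formal degree; (2) the first three entries of each of the last two rows of $\phi_2$ have formal degree strictly less than the multiplicity of $S$;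 (3) the induced subcomplex $P\xleftarrow{\phi_1'}P^4\xleftarrow{\phi_2'}P^4\xleftarrow{\phi_3'}P\leftarrow0$ is acyclic, where $\phi_1'$ consists of the first 4 columns of $\phi_1$, $\phi_2'$ of the first 4 rows and columns of $\phi_2$, and $\phi_3'$ of the first four rows of the first column of $\phi_3$. *)

(* Defs.v *)
From HB Require Import structures.
From mathcomp Require Import all_boot all_order all_algebra.
From mathcomp Require Import mpoly.

Set Implicit Arguments.
Unset Strict Implicit.
Unset Printing Implicit Defensive.

Import Order.TTheory GRing.Theory Num.Theory.

Definition numerical_semigroup (S : nat -> Prop) : Prop :=
  [/\ S 0,
      (forall x y, S x -> S y -> S (x + y)) &
      exists N, forall x, N <= x -> S x].

Definition generated (L : seq nat) : nat -> Prop :=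
  fun x => exists c : nat -> nat, x = \sum_(s <- L) c s * s.

Definition has_genus (S : nat -> Prop) (g : nat) : Prop :=
  exists gaps : seq nat,
    [/\ uniq gaps, (forall x, x \in gaps <-> 0 < x /\ ~ S x) & size gaps = g].

Definition is_multiplicity (S : nat -> Prop) (m : nat) : Prop :=
  [/\ S m, 0 < m & forall x, S x -> 0 < x -> m <= x].

Definition min_generator (S : nat -> Prop) (x : nat) : Prop :=
  [/\ S x, 0 < x &
      forall y z, S y -> S z -> 0 < y -> 0 < z -> x <> y + z].

(* Sortedness makes the tuple, hence P below, unique for a given S. *)
Definition is_min_generators (S : nat -> Prop) n (a : n.-tuple nat) : Prop :=
  sorted ltn a /\ forall x, x \in a <-> min_generator S x.

Local Open Scope ring_scope.

(* Modules are spaces of column vectors, so [exact_at A B] is exactness of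
   R^m <-A- R^n <-B- R^p at R^n. *)
Definition exact_at (R : pzRingType) m n p
    (A : 'M[R]_(m, n)) (B : 'M[R]_(n, p)) : Prop :=
  A *m B = 0 /\
  forall v : 'cV[R]_n, A *m v = 0 -> exists w : 'cV[R]_p, v = B *m w.

Definition mx_injective (R : pzRingType) m n (A : 'M[R]_(m, n)) : Prop :=
  forall v : 'cV[R]_n, A *m v = 0 -> v = 0.

(* R <-A- R^n1 <-B- R^n2 <-C- R^n3 <- 0 is a complex whose homology vanishes
   except at R. *)
Definition acyclic (R : pzRingType) n1 n2 n3
    (A : 'M[R]_(1, n1)) (B : 'M[R]_(n1, n2)) (C : 'M[R]_(n2, n3)) : Prop :=
  [/\ exact_at A B, exact_at B C & mx_injective C].

Section GradedResolution.

Variables (k : fieldType) (n : nat) (a : n.-tuple nat).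

Notation P := {mpoly k[n]}.

(* P is graded by deg 'X_i = tnth a i. *)
Definition wdeg (m : 'X_{1..n}) : nat := (\sum_(i < n) m i * tnth a i)%N.

Definition whomog (d : int) (p : P) : Prop :=
  forall m, m \in msupp p -> (wdeg m)%:Z = d.

Definition formal_degree p q (r : 'I_p -> int) (c : 'I_q -> int)
    (i : 'I_p) (j : 'I_q) : int := c j - r i.

(* A degree-0 map of graded free modules; [r] and [c] are the degrees of the
   basis elements of the target and of the source. *)
Definition graded_mx p q (r : 'I_p -> int) (c : 'I_q -> int)
    (A : 'M[P]_(p, q)) : Prop :=
  forall i j, whomog (formal_degree r c i j) (A i j).

(* All entries lie in the ideal generated by the variables. *)
Definition minimal_mx p q (A : 'M[P]_(p, q)) : Prop :=
  forall i j, (A i j)@_0%MM = 0.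

Definition semigroup_ring (S : nat -> Prop) (q : {poly k}) : Prop :=
  forall s : nat, q`_s != 0 -> S s.

(* The k-algebra map P -> k[t], 'X_i |-> t ^ (tnth a i), with kernel I. *)
Definition semigroup_map (p : P) : {poly k} :=
  mmap (@polyC k) (fun i => 'X^(tnth a i)) p.

(* 0 <- k[t^S] <- P <- P^b1 <- P^b2 <- P^b3 <- 0 is a minimal graded free
   resolution, where P^b1, P^b2, P^b3 have homogeneous bases of degrees
   d1, d2, d3 and P = P^1 is generated in degree 0. *)
Definition minimal_resolution (S : nat -> Prop) b1 b2 b3
    (d1 : 'I_b1 -> int) (d2 : 'I_b2 -> int) (d3 : 'I_b3 -> int)
    (phi1 : 'M[P]_(1, b1)) (phi2 : 'M[P]_(b1, b2)) (phi3 : 'M[P]_(b2, b3)) :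
    Prop :=
  [/\ [/\ graded_mx (fun=> 0) d1 phi1, graded_mx d1 d2 phi2 &
          graded_mx d2 d3 phi3],
      [/\ minimal_mx phi1, minimal_mx phi2 & minimal_mx phi3],
      (forall q, semigroup_ring S q <-> exists p, semigroup_map p = q),
      (forall p, semigroup_map p = 0 <->
         exists w : 'cV[P]_b1, p = (phi1 *m w) ord0 ord0) &
      acyclic phi1 phi2 phi3].

End GradedResolution.

(* The ranks 6, 8, 3 are split as 4 + 2, 4 + 4, 1 + 2, so that the primed
   matrices are the upper left blocks; being a subcomplex means that the lower
   left blocks vanish. Reorderings of the bases are absorbed by the existential
   quantification over resolutions with homogeneous bases. *)
Definition degree_special (k : fieldType) (S : nat -> Prop) : Prop :=
  exists n (a : n.-tuple nat) (mult : nat)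
    (d1 : 'I_(4 + 2) -> int) (d2 : 'I_(4 + 4) -> int) (d3 : 'I_(1 + 2) -> int)
    (phi1 : 'M[{mpoly k[n]}]_(1, 4 + 2))
    (phi2 : 'M[{mpoly k[n]}]_(4 + 2, 4 + 4))
    (phi3 : 'M[{mpoly k[n]}]_(4 + 4, 1 + 2)),
    [/\ is_min_generators S a,
        is_multiplicity S mult &
        minimal_resolution a S d1 d2 d3 phi1 phi2 phi3] /\
    [/\ forall i : 'I_4,
          formal_degree d2 d3 (rshift 4 i) (lshift 2 ord0) < 0,
        forall (i : 'I_2) (j : 'I_(4 + 4)), (j < 3)%N ->
          formal_degree d1 d2 (rshift 4 i) j < mult%:Z,
        dlsubmx phi2 = 0 /\ dlsubmx phi3 = 0 &
        acyclic (lsubmx phi1) (ulsubmx phi2) (ulsubmx phi3)].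

(* Main.v *)
(** Put r = 2e + 1 and let n and m be coprime. All three families are instances
    of one: the semigroup generated by 2n, rn, m and m + n, with
    (e, n, m) = (1, 3, g) in (i), (2, 3, g - 1) in (ii) and (1, 5, 8) in (iii).
    Let B = k[t^2, t^r, s, st] inside k[s, t], with deg t = n and deg s = m.
    Multiplication by s^n - t^m maps k[s, t] into B, because m > r and the only
    monomials of k[s, t] missing from B are t, t^3, ..., t^(r-2); B modulo the image
    is k[t^S]. Over P = k[x, y, z, w] the ring B has a resolution F of ranks
    1, 4, 4, 1, and k[s, t], generated by 1 and t, has a resolution G of ranks
    2, 4, 2. The mapping cone of a lift G -> F of the multiplication is the required
    resolution of k[t^S], and F is the required subcomplex.

    Kernels of maps sending monomials to monomials are computed by showing that two
    monomials with the same image are congruent modulo the candidate ideal.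
    Acyclicity of F and G then only needs a few regular pairs. *)
Require Import Defs.
From HB Require Import structures.
From mathcomp Require Import all_boot all_order all_algebra.
From mathcomp Require Import ring zify.
From mathcomp Require Import mpoly.

Set Implicit Arguments.
Unset Strict Implicit.
Unset Printing Implicit Defensive.

Import Order.TTheory GRing.Theory Num.Theory.
Local Open Scope ring_scope.

(** * Mapping cones and explicit matrices *)

(** By the long exact sequence, the homology of the cone at its first free module is the kernel of
    the map from coker [G1] to coker [F1] induced by [a0]; the last hypothesis makes it vanish. The
    signs of the cone are absorbed into [a1]. *)
Lemma cone_acyclic (R : pzRingType) (n1 n2 n3 m1 m2 m3 : nat)
    (F1 : 'M[R]_(1, n1)) (F2 : 'M[R]_(n1, n2)) (F3 : 'M[R]_(n2, n3))
    (G1 : 'M[R]_(m1, m2)) (G2 : 'M[R]_(m2, m3))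
    (a0 : 'M[R]_(1, m1)) (a1 : 'M[R]_(n1, m2)) (a2 : 'M[R]_(n2, m3)) :
    acyclic F1 F2 F3 -> exact_at G1 G2 -> mx_injective G2 ->
    F1 *m a1 + a0 *m G1 = 0 -> F2 *m a2 + a1 *m G2 = 0 ->
    (forall v1 v2, F1 *m v1 + a0 *m v2 = 0 -> exists w : 'cV_m2, v2 = G1 *m w) ->
  acyclic (row_mx F1 a0) (block_mx F2 a1 0 G1) (block_mx F3 a2 0 G2).
Proof.
move=> [[F12 eF1] [F23 eF2] iF3] [G12 eG] iG2 h1 h2 inj.
split.
- split; first by rewrite mul_row_block F12 h1 mulmx0 addr0 row_mx0.
  move=> v; rewrite -[v]vsubmxK mul_row_col => hv.
  have [w2 Ew2] := inj _ _ hv.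
  (* The [G] component is the boundary of [w2]; subtracting the boundary of [w2] in the cone leaves
     a cycle of [F]. *)
  have /eF1 [w1 Ew1] : F1 *m (usubmx v - a1 *m w2) = 0.
    rewrite mulmxBr mulmxA; move: hv; rewrite Ew2 mulmxA => hv.
    have -> : F1 *m a1 = - (a0 *m G1) by apply/eqP; rewrite -addr_eq0 h1.
    by rewrite mulNmx opprK.
  exists (col_mx w1 w2); rewrite mul_block_col -Ew1 -Ew2 mul0mx add0r.
  by rewrite addrNK.
- split.
    by rewrite mulmx_block !mulmx0 !mul0mx F23 h2 G12 ?(add0r, addr0) block_mx0.
  move=> v; rewrite -[v]vsubmxK mul_block_col mul0mx add0r -col_mx0.
  move/eq_col_mx => [hv /eG[w2 Ew2]].
  have /eF2 [w1 Ew1] : F2 *m (usubmx v - a2 *m w2) = 0.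
    rewrite mulmxBr mulmxA; move: hv; rewrite Ew2 mulmxA => hv.
    have -> : F2 *m a2 = - (a1 *m G2) by apply/eqP; rewrite -addr_eq0 h2.
    by rewrite mulNmx opprK.
  exists (col_mx w1 w2); rewrite mul_block_col -Ew1 -Ew2 mul0mx add0r.
  by rewrite addrNK.
move=> v; rewrite -[v]vsubmxK mul_block_col mul0mx add0r -!col_mx0.
by move/eq_col_mx => [hv /iG2 v2]; move: hv; rewrite v2 mulmx0 addr0 => /iF3 ->.
Qed.

Definition mx_of_rows (R : nzRingType) p q (L : seq (seq R)) : 'M[R]_(p, q) :=
  \matrix_(i, j) nth 0 (nth [::] L i) j.

Local Notation o0 := (@Ordinal 4 0 isT).
Local Notation o1 := (@Ordinal 4 1 isT).
Local Notation o2 := (@Ordinal 4 2 isT).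
Local Notation o3 := (@Ordinal 4 3 isT).
Local Notation b0 := (@Ordinal 2 0 isT).
Local Notation b1 := (@Ordinal 2 1 isT).

Lemma sum_ord4 (V : nmodType) (F : 'I_4 -> V) :
  \sum_i F i = F o0 + F o1 + F o2 + F o3.
Proof.
rewrite !big_ord_recl big_ord0 addr0 !addrA.
by do ![congr (_ + _) | congr (F _); apply: val_inj].
Qed.

Lemma sum_ord2 (V : nmodType) (F : 'I_2 -> V) : \sum_i F i = F b0 + F b1.
Proof.
rewrite !big_ord_recl big_ord0 addr0.
by do ![congr (_ + _) | congr (F _); apply: val_inj].
Qed.

Lemma sum_ord1 (V : nmodType) (F : 'I_1 -> V) : \sum_i F i = F ord0.
Proof. by rewrite big_ord1. Qed.

Lemma forall_ord4 (P : 'I_4 -> Prop) :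
  P o0 -> P o1 -> P o2 -> P o3 -> forall i, P i.
Proof.
move=> H0 H1 H2 H3 [[|[|[|[|i]]]] Hi] //.
- by rewrite (_ : Ordinal Hi = o0) //; apply: val_inj.
- by rewrite (_ : Ordinal Hi = o1) //; apply: val_inj.
- by rewrite (_ : Ordinal Hi = o2) //; apply: val_inj.
- by rewrite (_ : Ordinal Hi = o3) //; apply: val_inj.
Qed.

Lemma forall_ord2 (P : 'I_2 -> Prop) : P b0 -> P b1 -> forall i, P i.
Proof.
move=> H0 H1 [[|[|i]] Hi] //.
- by rewrite (_ : Ordinal Hi = b0) //; apply: val_inj.
- by rewrite (_ : Ordinal Hi = b1) //; apply: val_inj.
Qed.

Lemma forall_ord1 (P : 'I_1 -> Prop) : P ord0 -> forall i, P i.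
Proof. by move=> H i; rewrite ord1. Qed.

Section Complexes.
Variable (R : comNzRingType).
Variables (x xe y z w h al be ze : R).

(* Here x = t^2, xe = x^e, y = t^r, z = s and w = st; A, B, C, D generate the
   kernel of P -> B, and F resolves it. G resolves k[s, t], with generators 1, t.
   Exactly one of al, be is 1 (the other is 0) according to the parity of m, so that
   h * (al * xe + be * y) and h * (al * y + be * x * xe) are monomials mapping to
   t^m and t^(m+1); with ze = z^(n-1), p and q therefore map to s^n - t^m
   and t * (s^n - t^m). The chain map G -> F is (a0, - a1, a2). *)
Definition gA := x * xe * xe - y * y.
Definition gB := y * z - xe * w.
Definition gC := x * xe * z - y * w.
Definition gD := w * w - x * z * z.
Definition gp := z * ze - h * (al * xe + be * y).
Definition gq := w * ze - h * (al * y + be * x * xe).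

Definition F1 : 'M[R]_(1, 4) := mx_of_rows 1 4 [:: [:: gA; gB; gC; gD]].
Definition F2 : 'M[R]_4 := mx_of_rows 4 4
  [:: [:: z; w; 0; 0]; [:: y; x * xe; w; x * z];
      [:: - xe; - y; z; w]; [:: 0; 0; xe; y]].
Definition F3 : 'M[R]_(4, 1) := mx_of_rows 4 1
  [:: [:: w]; [:: - z]; [:: - y]; [:: xe]].
Definition G1 : 'M[R]_(2, 4) := mx_of_rows 2 4
  [:: [:: y; x * xe; w; x * z]; [:: - xe; - y; - z; - w]].
Definition G2 : 'M[R]_(4, 2) := mx_of_rows 4 2
  [:: [:: w; x * z]; [:: z; w]; [:: - y; - (x * xe)]; [:: - xe; - y]].
Definition a0 : 'M[R]_(1, 2) := mx_of_rows 1 2 [:: [:: gp; gq]].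
Definition a1 : 'M[R]_4 := mx_of_rows 4 4
  [:: [:: - (be * h); al * h; 0; 0]; [:: - ze; 0; - (al * h); be * (x * h)];
      [:: 0; - ze; - (be * h); al * h]; [:: 0; 0; 0; ze]].
Definition a2 : 'M[R]_(4, 2) := mx_of_rows 4 2
  [:: [:: - (al * h); be * (x * h)]; [:: be * h; - (al * h)];
      [:: ze; 0]; [:: 0; ze]].

Ltac entries := rewrite ?mxE ?(sum_ord4, sum_ord2, sum_ord1) ?mxE /=.

Lemma F12 : F1 *m F2 = 0.
Proof.
apply/matrixP; apply: forall_ord1; apply: forall_ord4; entries.
all: rewrite /gA /gB /gC /gD; ring.
Qed.
Lemma F23 : F2 *m F3 = 0.
Proof.
apply/matrixP => i j; move: i; rewrite [j]ord1; apply: forall_ord4; entries; ring.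
Qed.
Lemma G12 : G1 *m G2 = 0.
Proof.
apply/matrixP; apply: forall_ord2; apply: forall_ord2; entries; ring.
Qed.
Lemma chain1 : F1 *m a1 + a0 *m G1 = 0.
Proof.
apply/matrixP; apply: forall_ord1; apply: forall_ord4; entries.
all: rewrite ?mxE ?(sum_ord4, sum_ord2) ?mxE /=.
all: rewrite /gA /gB /gC /gD /gp /gq; ring.
Qed.
Lemma chain2 : F2 *m a2 + a1 *m G2 = 0.
Proof.
apply/matrixP; apply: forall_ord4; apply: forall_ord2; entries.
all: rewrite ?mxE ?(sum_ord4, sum_ord2) ?mxE /=; ring.
Qed.
End Complexes.

(** * Acyclicity from regular pairs *)

Section Regular.
Variable (R : idomainType).

(** Exactness of the Koszul complex of [f] and [g] in the middle. *)
Definition regular_pair (f g : R) : Prop :=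
  forall a b, f * a + g * b = 0 -> exists c, a = g * c /\ b = - (f * c).

(** As the kernel of a map to a domain, the ideal of [g] is prime; [f] lies outside it and so is a
    nonzerodivisor modulo [g]. *)
Lemma regular_pair_kernel (S : idomainType) (pi : {rmorphism R -> S}) (f g : R) :
    g != 0 -> pi g = 0 -> pi f != 0 ->
    (forall u, pi u = 0 -> exists c, u = g * c) ->
  regular_pair f g.
Proof.
move=> g0 pig pif ker a b E.
have /ker[c Ec] : pi a = 0.
  apply/eqP; have : pi f * pi a == 0.
    by rewrite -rmorphM (_ : f * a = - (g * b)) ?rmorphN ?rmorphM ?pig ?mul0r ?oppr0 //;
       apply/eqP; rewrite -addr_eq0 E.
  by rewrite mulf_eq0 (negbTE pif).
exists c; split=> //; apply: (mulfI g0); apply/eqP; rewrite -subr_eq0 -[X in _ == X]E Ec.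
by apply/eqP; ring.
Qed.

Variables (x xe y z w : R).
Notation A := (gA x xe y).
Notation B := (gB xe y z w).
Notation C := (gC x xe y z w).
Notation D := (gD x z w).
Notation F1 := (F1 x xe y z w).
Notation F2 := (F2 x xe y z w).
Notation F3 := (F3 xe y z w).
Notation G1 := (G1 x xe y z w).
Notation G2 := (G2 x xe y z w).

Ltac entries := rewrite ?mxE ?(sum_ord4, sum_ord2, sum_ord1) ?mxE /=.

Hypothesis xe0 : xe != 0.
Hypothesis rzw : regular_pair z w.
Hypothesis rxy : regular_pair xe y.
Hypothesis ryz : regular_pair y z.
Hypothesis rCA : regular_pair C A.
Hypothesis rDA : regular_pair D A.
Hypothesis D_nzd : forall v, (exists a b, D * v = xe * a + y * b) ->
  exists a b, v = xe * a + y * b.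
Hypothesis A_nzd : forall v, (exists a b, A * v = z * a + w * b) ->
  exists a b, v = z * a + w * b.
Hypothesis A0 : A != 0.
Hypothesis C0 : C != 0.
Hypothesis y0 : y != 0.

Lemma F3_inj : mx_injective F3.
Proof.
move=> v /matrixP E; have := E o3 ord0; entries => /eqP.
rewrite mulf_eq0 (negbTE xe0) /= => /eqP v0.
by apply/colP => i; rewrite ord1 v0 mxE.
Qed.

(** Rows 0 and 3 of [F2] give syzygies of [(z, w)] and [(xe, y)], which leaves two parameters [c]
    and [d]; row 1 then reads [- C * (c + d) = 0]. *)
Lemma exact_F23 : exact_at F2 F3.
Proof.
split; first exact: F23.
move=> v /matrixP E; have := E o3 ord0; have := E o0 ord0; have := E o1 ord0.
entries; rewrite !mul0r !addr0 !add0r.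
move=> E1 /rzw[c [E0a E0b]] /rxy[d [E3a E3b]].
have /eqP : C * (c + d) = 0.
  transitivity (- (y * v o0 ord0 + x * xe * v o1 ord0 + w * v o2 ord0
     + x * z * v o3 ord0)); last by rewrite E1 oppr0.
  by rewrite E0a E0b E3a E3b /gC; ring.
rewrite mulf_eq0 (negbTE C0) /= addr_eq0 => /eqP Ecd.
exists (const_mx c); apply/colP; apply: forall_ord4; entries.
- by rewrite E0a.
- by rewrite E0b mulNr.
- by rewrite E3a Ecd; ring.
- by rewrite E3b Ecd; ring.
Qed.

(** Since [A], [B], [C] lie in the ideal [(xe, y)], so does the coefficient of [D] in a syzygy, and
    the last two columns of [F2] remove it. A syzygy of [A], [B], [C] remains, to be treated through
    the pair [(C, A)]. *)
Lemma exact_F12 : exact_at F1 F2.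
Proof.
split; first exact: F12.
move=> v /matrixP E; have {E} := E ord0 ord0; entries => E.
set v0 := v o0 ord0 in E *; set v1 := v o1 ord0 in E *.
set v2 := v o2 ord0 in E *; set v3 := v o3 ord0 in E *.
have [|a [b E3]] := D_nzd (v := v3).
  exists (- (x * xe * v0 - w * v1 + x * z * v2)), (y * v0 - z * v1 + w * v2).
  have -> : D * v3 = A * v0 + B * v1 + C * v2 + D * v3
     - (A * v0 + B * v1 + C * v2) by ring.
  by rewrite E /gA /gB /gC; ring.
pose v1' := v1 - w * a - x * z * b; pose v2' := v2 - z * a - w * b.
(* Multiplication by [y] eliminates [B], because [y * B = xe * C - z * A]. *)
have [|c [Ec1 Ec2]] := rCA (a := y * v2' + xe * v1') (b := y * v0 - z * v1').
  transitivity (y * (A * v0 + B * v1 + C * v2 + D * v3)); last by rewrite E mulr0.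
  by rewrite E3 /v1' /v2' /gA /gB /gC /gD; ring.
(* Expanding [C] in [y * v0 - z * v1' = - (C * c)] gives a syzygy of [(y, z)]. *)
have [|d [Ed1 Ed2]] := ryz (a := v0 - w * c) (b := x * xe * c - v1').
  transitivity (y * v0 - z * v1' + C * c); first by rewrite /gC; ring.
  by rewrite Ec2; ring.
have E0 : v0 = z * d + w * c by rewrite -Ed1; ring.
have E1 : v1' = x * xe * c + y * d by rewrite -[y * d]opprK -Ed2; ring.
have E2 : v2' = - (y * c) - xe * d.
  apply: (mulfI y0); transitivity (y * v2' + xe * v1' - xe * v1'); first by ring.
  by rewrite Ec1 E1 /gA; ring.
exists (mx_of_rows 4 1 [:: [:: d]; [:: c]; [:: a]; [:: b]]).
apply/colP; apply: forall_ord4; entries.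
- by rewrite -/v0 E0; ring.
- transitivity (v1' + w * a + x * z * b); first by rewrite /v1' -/v1; ring.
  by rewrite E1; ring.
- transitivity (v2' + z * a + w * b); first by rewrite /v2' -/v2; ring.
  by rewrite E2; ring.
- by rewrite -/v3 E3; ring.
Qed.

Lemma F_acyclic : acyclic F1 F2 F3.
Proof. by split; [exact: exact_F12 | exact: exact_F23 | exact: F3_inj]. Qed.

Lemma G2_inj : mx_injective G2.
Proof.
move=> v /matrixP E; have := E o2 ord0; have := E o3 ord0; entries.
set c0 := v b0 ord0; set c1 := v b1 ord0 => E1 E0.
have /eqP : A * c0 = 0.
  transitivity (y * (- y * c0 + - (x * xe) * c1) - x * xe * (- xe * c0 + - y * c1)).
    by rewrite /gA; ring.
  by rewrite E0 E1; ring.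
rewrite mulf_eq0 (negbTE A0) /= => /eqP v0.
move: E1; rewrite v0 mulr0 add0r => /eqP; rewrite mulf_eq0 oppr_eq0 (negbTE y0) /=.
move=> /eqP v1.
by apply/colP; apply: forall_ord2; rewrite !mxE.
Qed.

(** Up to signs of basis elements, [G] is the Koszul complex of [y - xe * t] and [w - z * t] over
    [R[t]/(t^2 - x)]. Their norms to [R] are [- A] and [D], which brings in the pair [(D, A)]. *)
Lemma exact_G12 : exact_at G1 G2.
Proof.
split; first exact: G12.
move=> v /matrixP E; have := E b0 ord0; have := E b1 ord0; entries.
set v0 := v o0 ord0; set v1 := v o1 ord0.
set v2 := v o2 ord0; set v3 := v o3 ord0 => E1 E0.
(* Here [e0 - e1 * t] is [(y + xe * t) * (v2 - v3 * t)], and [M0], [M1] are the coefficients of [(w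
   - z * t) * (e0 - e1 * t) = A * (v0 - v1 * t)]. Multiplying by the conjugate [w + z * t] then
   shows that [A] divides [e0] and [e1]. *)
pose e0 := y * v2 - x * xe * v3; pose e1 := - (xe * v2) + y * v3.
pose T0 := y * v0 + x * xe * v1 + w * v2 + x * z * v3.
pose T1 := - xe * v0 + - y * v1 + - z * v2 + - w * v3.
have M0 : w * e0 + x * z * e1 = A * v0.
  transitivity (A * v0 + y * T0 + x * xe * T1).
    by rewrite /e0 /e1 /T0 /T1 /gA; ring.
  by rewrite /T0 /T1 E0 E1; ring.
have M1 : z * e0 + w * e1 = A * v1.
  transitivity (A * v1 - xe * T0 - y * T1).
    by rewrite /e0 /e1 /T0 /T1 /gA; ring.
  by rewrite /T0 /T1 E0 E1; ring.
have [|c0 [Ec0 _]] := rDA (a := e0) (b := - (w * v0 - x * z * v1)).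
  transitivity (w * (w * e0 + x * z * e1 - A * v0) - x * z * (z * e0 + w * e1 - A * v1)).
    by rewrite /gD; ring.
  by rewrite M0 M1; ring.
have [|c1 [Ec1 _]] := rDA (a := e1) (b := z * v0 - w * v1).
  transitivity (- z * (w * e0 + x * z * e1 - A * v0) + w * (z * e0 + w * e1 - A * v1)).
    by rewrite /gD; ring.
  by rewrite M0 M1; ring.
exists (mx_of_rows 2 1 [:: [:: c0]; [:: c1]]).
apply/colP; apply: forall_ord4; entries; apply: (mulfI A0).
- by rewrite -M0 Ec0 Ec1; ring.
- by rewrite -M1 Ec0 Ec1; ring.
- transitivity (- (y * e0 + x * xe * e1)); first by rewrite /e0 /e1 -/v2 /gA; ring.
  by rewrite Ec0 Ec1; ring.
- transitivity (- (xe * e0 + y * e1)); first by rewrite /e0 /e1 -/v3 /gA; ring.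
  by rewrite Ec0 Ec1; ring.
Qed.

(** This is the injectivity of multiplication by s from k[s, t] to B, which sends the generators 1
    and t to [z] and [w]. As [B], [C], [D] lie in [(z, w)], so does the coefficient of [A]; since
    [z * A] and [w * A] are combinations of [B] and [C], only a syzygy of [(z, w)] is left. *)
Lemma G1_kernel (v : 'cV_2) :
    (exists u : 'cV_4, z * v b0 ord0 + w * v b1 ord0 = (F1 *m u) ord0 ord0) ->
  exists u : 'cV_4, v = G1 *m u.
Proof.
move=> [u]; entries; set v0 := v b0 ord0; set v1 := v b1 ord0.
set u0 := u o0 ord0; set u1 := u o1 ord0; set u2 := u o2 ord0; set u3 := u o3 ord0.
move=> E.
have [|a0 [a1 Ea]] := A_nzd (v := u0).
  exists (v0 - y * u1 - x * xe * u2 + x * z * u3), (v1 + xe * u1 + y * u2 - w * u3).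
  transitivity (A * u0 + B * u1 + C * u2 + D * u3 - (B * u1 + C * u2 + D * u3)).
    by ring.
  by rewrite -E /gB /gC /gD; ring.
pose u1' := u1 - y * a0 - x * xe * a1; pose u2' := u2 + xe * a0 + y * a1.
have [|g [Eg1 Eg2]] := rzw (a := v0 - y * u1' - x * xe * u2' + x * z * u3)
    (b := v1 + xe * u1' + y * u2' - w * u3).
  transitivity (z * v0 + w * v1 - (A * u0 + B * u1 + C * u2 + D * u3)).
    by rewrite Ea /u1' /u2' /gA /gB /gC /gD; ring.
  by rewrite E; ring.
exists (mx_of_rows 4 1 [:: [:: u1']; [:: u2']; [:: g]; [:: - u3]]).
apply/colP; apply: forall_ord2; entries.
- by rewrite -Eg1 -/v0; ring.
- transitivity ((v1 + xe * u1' + y * u2' - w * u3) - xe * u1' - y * u2' + w * u3).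
    by rewrite -/v1; ring.
  by rewrite Eg2; ring.
Qed.
End Regular.

(** * Kernels of monomial maps *)

(** Split [f] along the fibres of [key]. On each fibre the coefficients sum to zero, so that part is
    a combination of differences with one fixed monomial of the fibre. *)
Lemma monomial_kernel (R : comNzRingType) n (K : eqType) (key : 'X_{1..n} -> K)
    (N : {mpoly R[n]} -> Prop) (f : {mpoly R[n]}) :
    N 0 -> (forall p q, N p -> N q -> N (p + q)) ->
    (forall p q, N q -> N (p * q)) ->
    (forall m m', key m = key m' -> N ('X_[m] - 'X_[m'])) ->
    (forall c, \sum_(m <- msupp f | key m == c) f@_m = 0) ->
  N f.
Proof.
move=> N0 ND NM Nkey sum0; rewrite [f]mpolyE.
have -> : \sum_(m <- msupp f) f@_m *: 'X_[m] =
  \sum_(c <- undup (map key (msupp f)))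
     \sum_(m <- msupp f | key m == c) f@_m *: 'X_[m].
  rewrite (exchange_big_dep predT) //=; apply: eq_big_seq => m ms.
  rewrite (big_rem (key m)) ?mem_undup ?map_f //= eqxx big1_seq ?addr0 //.
  move=> c /andP[/eqP <-]; rewrite mem_rem_uniq ?undup_uniq //.
  by rewrite inE eqxx.
elim/big_ind: _ => // c _.
have [m0 /eqP m0c|none] := pickP (fun i : seq_sub (msupp f) => key (val i) == c).
  have -> : \sum_(m <- msupp f | key m == c) f@_m *: 'X_[m] =
     \sum_(m <- msupp f | key m == c) f@_m *: ('X_[m] - 'X_[val m0]).
    under [RHS]eq_bigr do rewrite scalerBr.
    by rewrite sumrB -scaler_suml sum0 scale0r subr0.
  elim/big_ind: _ => // m /eqP mc.
  by rewrite -mul_mpolyC; apply/NM/Nkey; rewrite mc m0c.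
rewrite big1_seq // => m /andP[mc ms].
by have := none (SeqSub ms); rewrite mc.
Qed.

(** The sum over the fibre of [c] is the coefficient of ['X_[c]] in the image of [f]. *)
Lemma mmap_monomial_key (R : comNzRingType) n p (mu : 'I_n -> 'X_{1..p}) f :
    mmap (@mpolyC p R) (fun i => 'X_[mu i]) f = 0 ->
  forall c, \sum_(m <- msupp f | (\sum_i mu i *+ m i)%MM == c) f@_m = 0.
Proof.
move=> f0 c; transitivity (mmap (@mpolyC p R) (fun i => 'X_[mu i]) f)@_c; last first.
  by rewrite f0 mcoeff0.
rewrite /mmap raddf_sum [LHS]big_mkcond /=; apply: eq_bigr => m _.
rewrite mcoeffCM (_ : mmap1 _ m = 'X_[\sum_i mu i *+ m i]).
  by rewrite mcoeffX; case: eqP; rewrite ?mulr1 ?mulr0.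
rewrite /mmap1 (big_morph _ (@mpolyXD p R) (@mpolyX0 p R)).
by apply: eq_bigr => i _; rewrite mpolyXn.
Qed.

Lemma semigroup_map_coef (k : fieldType) n (a : n.-tuple nat) (f : {mpoly k[n]}) d :
  (semigroup_map a f)`_d = \sum_(m <- msupp f | wdeg a m == d) f@_m.
Proof.
rewrite /semigroup_map /mmap coef_sum [RHS]big_mkcond /=; apply: eq_bigr => m _.
rewrite coefCM (_ : mmap1 _ m = 'X^(wdeg a m)).
  by rewrite coefXn eq_sym; case: eqP; rewrite ?mulr1 ?mulr0.
rewrite /mmap1 /wdeg (eq_bigr (fun i => 'X^(m i * tnth a i))).
  by rewrite prodrXr.
by move=> i _; rewrite -exprM mulnC.
Qed.

Lemma semigroup_mapX (k : fieldType) n (a : n.-tuple nat) m :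
  semigroup_map a 'X_[k, m] = 'X^(wdeg a m).
Proof.
apply/polyP => d; rewrite semigroup_map_coef msuppX big_mkcond big_seq1 coefXn.
by rewrite mcoeffX eqxx eq_sym; case: eqP.
Qed.

Lemma semigroup_map_is_semigroup_ring (k : fieldType) n (a : n.-tuple nat)
    (S : nat -> Prop) :
    (forall s, S s <-> exists m, wdeg a m = s) ->
  forall q : {poly k}, semigroup_ring S q <-> exists p, semigroup_map a p = q.
Proof.
move=> HS q; split=> [Sq|[p <-] s].
  have : exists p, semigroup_map a p = \sum_(i < size q) q`_i *: 'X^i.
    elim/big_ind: _ => [|_ _ [p1 <-] [p2 <-]|i _].
    - by exists 0; rewrite /semigroup_map mmap0.
    - by exists (p1 + p2); rewrite /semigroup_map mmapD.
    have [->|/Sq/HS[m Em]] := eqVneq q`_i 0.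
      by exists 0; rewrite /semigroup_map mmap0 scale0r.
    exists (q`_i *: 'X_[m]).
    by rewrite /semigroup_map mmapZ -/(semigroup_map a _) semigroup_mapX Em mul_polyC.
  by rewrite -poly_def coefK.
rewrite semigroup_map_coef => Hs; apply/HS.
have /hasP[m _ /eqP Em] : has (fun m => wdeg a m == s) (msupp p).
  by apply: contraNT Hs => Hs; rewrite big_hasC.
by exists m.
Qed.

(** * Homogeneous elements without constant term *)

Section HomogeneousPositive.
Variables (k : fieldType) (n : nat) (a : n.-tuple nat).

(** Homogeneity and the vanishing constant term are carried together, so that one check of the
    entries of a matrix gives both gradedness and minimality. *)
Definition hpos (d : int) (f : {mpoly k[n]}) : Prop := whomog a d f /\ f@_0%MM = 0.

Lemma wdegD m m' : wdeg a (m + m')%MM = (wdeg a m + wdeg a m')%N.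
Proof. by rewrite /wdeg -big_split; apply: eq_bigr => i _; rewrite mnmDE mulnDl. Qed.

Lemma hpos0 d : hpos d 0.
Proof. by split; [move=> m; rewrite msupp0 | rewrite mcoeff0]. Qed.

Lemma hposN d f : hpos d f -> hpos d (- f).
Proof.
by move=> [hf f0]; split; [move=> m; rewrite (perm_mem (msuppN f)) => /hf | rewrite mcoeffN f0 oppr0].
Qed.

Lemma hposD d f g : hpos d f -> hpos d g -> hpos d (f + g).
Proof.
move=> [hf f0] [hg g0]; split; last by rewrite mcoeffD f0 g0 addr0.
by move=> m /msuppD_le; rewrite mem_cat => /orP[/hf|/hg].
Qed.

Lemma hposM d d' f g : hpos d f -> hpos d' g -> hpos (d + d') (f * g).
Proof.
move=> [hf f0] [hg g0]; split; last by rewrite rmorphM /= f0 mul0r.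
move=> m /msuppM_le /allpairsP[[m1 m2] /= [/hf <- /hg <- ->]].
by rewrite wdegD PoszD.
Qed.

Lemma hposX i : 0 < (tnth a i)%:Z -> hpos (tnth a i) 'X_i.
Proof.
split; last first.
  rewrite mcoeffX; case: eqP => // /(congr1 (fun m : 'X_{1..n} => m i)).
  by rewrite mnm1E eqxx mnm0E.
move=> m; rewrite msuppX inE => /eqP ->.
rewrite /wdeg (bigD1 i) //= big1 ?addn0; last first.
  by move=> j ji; rewrite mnm1E eq_sym (negbTE ji).
by rewrite mnm1E eqxx mul1n.
Qed.

Lemma hposXn d f j : hpos d f -> (0 < j)%N -> hpos (d * j%:Z) (f ^+ j).
Proof.
case: j => // j hf _; elim: j => [|j IH]; first by rewrite mulr1.
by rewrite exprS -addn1 PoszD mulrDr mulr1 addrC; apply: hposM.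
Qed.

Lemma hpos_nat d f (b : bool) : (b -> hpos d f) -> hpos d (b%:R * f).
Proof. by case: b => [/(_ isT)|_]; rewrite ?mul1r // mul0r; apply: hpos0. Qed.

Lemma hpos_eq d d' f : hpos d f -> d = d' -> hpos d' f.
Proof. by move=> hf <-. Qed.

Definition hpos_mx p q (r : 'I_p -> int) (c : 'I_q -> int)
    (M : 'M[{mpoly k[n]}]_(p, q)) : Prop :=
  forall i j, hpos (formal_degree r c i j) (M i j).

Lemma hpos_mxP p q (r : 'I_p -> int) (c : 'I_q -> int) M :
  hpos_mx r c M -> graded_mx a r c M /\ minimal_mx M.
Proof. by move=> hM; split=> i j; have [] := hM i j. Qed.

Lemma hpos_row_mx p q1 q2 (r : 'I_p -> int) (c : 'I_(q1 + q2) -> int) M1 M2 :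
    hpos_mx r (c \o lshift q2) M1 -> hpos_mx r (c \o @rshift q1 q2) M2 ->
  hpos_mx r c (row_mx M1 M2).
Proof.
move=> h1 h2 i j; case: (split_ordP j) => j' ->; rewrite ?row_mxEl ?row_mxEr.
  exact: h1.
exact: h2.
Qed.

Lemma hpos_block_mx p1 p2 q1 q2 (r : 'I_(p1 + p2) -> int) (c : 'I_(q1 + q2) -> int)
    M1 M2 M3 :
    hpos_mx (r \o lshift p2) (c \o lshift q2) M1 ->
    hpos_mx (r \o lshift p2) (c \o @rshift q1 q2) M2 ->
    hpos_mx (r \o @rshift p1 p2) (c \o @rshift q1 q2) M3 ->
  hpos_mx r c (block_mx M1 M2 0 M3).
Proof.
move=> h1 h2 h3 i j; case: (split_ordP i) => i' ->; case: (split_ordP j) => j' ->.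
- rewrite block_mxEul; exact: h1.
- rewrite block_mxEur; exact: h2.
- rewrite block_mxEdl mxE; exact: hpos0.
- rewrite block_mxEdr; exact: h3.
Qed.
End HomogeneousPositive.

(** * Setting a variable to zero *)

Section KillVariable.
Variables (R : comNzRingType) (n : nat).

Definition kill (i : 'I_n) : {mpoly R[n]} -> {mpoly R[n]} :=
  mmap (@mpolyC n R) (fun j => if j == i then 0 else 'X_j).

HB.instance Definition _ i := GRing.RMorphism.copy (kill i)
  (mmap (@mpolyC n R) (fun j => if j == i then 0 else 'X_j)).

Lemma killX i j : kill i 'X_j = if j == i then 0 else 'X_j.
Proof. by rewrite /kill mmapX mmap1U. Qed.

Lemma kill_sub i f : exists c, f - kill i f = 'X_i * c.
Proof.
elim/mpolyind: f => [|c m p _ _ [d Ed]].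
  by exists 0; rewrite rmorph0 subr0 mulr0.
have [b Eb] : exists b, 'X_[m] - kill i 'X_[m] = 'X_i * b.
  have -> : kill i 'X_[m] = \prod_j (if j == i then 0 else 'X_j) ^+ m j.
    by rewrite /kill mmapX.
  have [mi|mi] := posnP (m i).
    exists 0; rewrite mulr0 mpolyXE_id; apply/eqP; rewrite subr_eq0; apply/eqP.
    by apply: eq_bigr => j _; case: eqP => // ->; rewrite mi !expr0.
  rewrite mpolyXE_id (bigD1 i) //= [X in _ - X](bigD1 i) //= eqxx.
  rewrite -(prednK mi) expr0n /= mul0r subr0 exprS -mulrA.
  by eexists.
exists (c%:MP * b + d); rewrite rmorphD /= opprD addrACA Ed -mul_mpolyC rmorphM /=.
have -> : kill i c%:MP = c%:MP by rewrite /kill mmapC.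
by rewrite -mulrBr Eb mulrDr mulrCA.
Qed.

Lemma kill_kernel i f : kill i f = 0 -> exists c, f = 'X_i * c.
Proof. by move=> f0; have [c] := kill_sub i f; rewrite f0 subr0; exists c. Qed.
End KillVariable.

Lemma regular_pair_kill (R : idomainType) n i (f : {mpoly R[n]}) :
  kill i f != 0 -> regular_pair f 'X_i.
Proof.
move=> fi; apply: (@regular_pair_kernel _ _ (@kill R n i)) => //.
- by rewrite -msupp_eq0 msuppX.
- by rewrite /= killX eqxx.
by move=> u /kill_kernel.
Qed.

(** * The family of resolutions *)

Section Family.
Variables (k : fieldType) (ix iy iz iw : 'I_4).
Hypothesis vars_uniq : uniq [:: ix; iy; iz; iw].
Notation P := {mpoly k[4]}.
Notation x := ('X_ix : P).
Notation y := ('X_iy : P).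
Notation z := ('X_iz : P).
Notation w := ('X_iw : P).

(** The generators of the semigroup are listed in increasing order, and the places of 2n, rn, m and
    m + n in that list vary with the family; hence the four variables are named by an arbitrary
    enumeration of ['I_4]. *)
Definition sel T (p q r s : T) (i : 'I_4) : T :=
  if i == ix then p else if i == iy then q else if i == iz then r else s.

Lemma vars_neq : ((ix == iy) = false) * ((ix == iz) = false) * ((ix == iw) = false) *
  ((iy == iz) = false) * ((iy == iw) = false) * ((iz == iw) = false) *
  ((iy == ix) = false) * ((iz == ix) = false) * ((iw == ix) = false) *
  ((iz == iy) = false) * ((iw == iy) = false) * ((iw == iz) = false).
Proof.
move: vars_uniq; rewrite /= !inE !negb_or => /and4P[/and3P[? ? ?] /andP[? ?] ? _].
by do !split; apply: negbTE; rewrite // eq_sym.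
Qed.

Lemma selE T (p q r s : T) : (sel p q r s ix = p) * (sel p q r s iy = q) *
  (sel p q r s iz = r) * (sel p q r s iw = s).
Proof. by rewrite /sel !eqxx !vars_neq. Qed.

Lemma big_vars (T : Type) (idx : T) (op : Monoid.com_law idx) (F : 'I_4 -> T) :
  \big[op/idx]_i F i = op (op (op (F ix) (F iy)) (F iz)) (F iw).
Proof.
have vars_perm : perm_eq (index_enum 'I_4) [:: ix; iy; iz; iw].
  rewrite perm_sym; apply: uniq_perm => //; first exact: index_enum_uniq.
  have [_ E] := uniq_min_size vars_uniq (s2 := index_enum 'I_4)
    (fun i _ => mem_index_enum i) ltac:(by rewrite [index_enum _]unlock -enumT size_enum_ord).
  by move=> i; rewrite E.
by rewrite (perm_big _ vars_perm) !big_cons big_nil Monoid.mulm1 !Monoid.mulmA.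
Qed.

Lemma mpolyX_vars m : 'X_[m] = x ^+ m ix * y ^+ m iy * z ^+ m iz * w ^+ m iw.
Proof. by rewrite mpolyXE_id big_vars. Qed.

Lemma key_vars (p q r s m : 'X_{1..4}) j :
  (\sum_i sel p q r s i *+ m i)%MM j =
  (p j * m ix + q j * m iy + r j * m iz + s j * m iw)%N.
Proof. by rewrite mnm_sumE big_vars !mulmnE !selE. Qed.

(** * Normal forms of monomials and the kernels of [psi] and [phi] *)

Variable e : nat.
Notation xe := (x ^+ e).
Notation r := (2 * e + 1)%N.
Notation A := (gA x xe y).
Notation B := (gB xe y z w).
Notation C := (gC x xe y z w).
Notation D := (gD x z w).

(* psi is P -> k[s, t] and phi is P -> k[t, z, w], both realized inside P with t
   written as x, and s as z. *)
Definition psi_var : 'I_4 -> P := fun i =>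
  'X_[sel (U_(ix) *+ 2)%MM (U_(ix) *+ r)%MM U_(iz)%MM (U_(iz) + U_(ix))%MM i].
Definition phi_var : 'I_4 -> P := fun i =>
  'X_[sel (U_(ix) *+ 2)%MM (U_(ix) *+ r)%MM U_(iz)%MM U_(iw)%MM i].
Notation psi := (mmap (@mpolyC 4 k) psi_var).
Notation phi := (mmap (@mpolyC 4 k) phi_var).

Lemma psiE : (psi x = x ^+ 2) * (psi y = x ^+ r) * (psi z = z) * (psi w = z * x).
Proof.
by rewrite !mmapX !mmap1U /psi_var !selE -!mpolyXn mpolyXD.
Qed.

Lemma phiE : (phi x = x ^+ 2) * (phi y = x ^+ r) * (phi z = z) * (phi w = w).
Proof. by rewrite !mmapX !mmap1U /phi_var !selE -!mpolyXn. Qed.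

Lemma exprr : x ^+ r = x * xe * xe.
Proof. by rewrite addn1 exprS mul2n -addnn exprD mulrA. Qed.

Lemma expr2e : (x ^+ 2) ^+ e = xe * xe.
Proof. by rewrite exprAC expr2. Qed.

Lemma psiF : (psi A = 0) * (psi B = 0) * (psi C = 0) * (psi D = 0).
Proof.
rewrite /gA /gB /gC /gD !rmorphB !rmorphM !rmorphXn /= !psiE expr2e exprr.
by do !split; ring.
Qed.

Lemma phiA : phi A = 0.
Proof.
rewrite /gA rmorphB !rmorphM !rmorphXn /= !phiE expr2e exprr; ring.
Qed.

(* [normal i j f]: [f] is the chosen monomial of [P] mapped by [psi] to s^i t^j. *)
Inductive normal : nat -> nat -> P -> Prop :=
| Normal_even q : normal 0 (2 * q) (x ^+ q)
| Normal_odd q : normal 0 (2 * q + r) (y * x ^+ q)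
| NormalS_even i q : normal i.+1 (2 * q) (z ^+ i * z * x ^+ q)
| NormalS_odd i q : normal i.+1 (2 * q + 1) (z ^+ i * w * x ^+ q).

(** As [r] is odd, the parity of [j] separates the two constructors available for a given [i]. *)
Lemma normal_unique i j f i' j' f' :
  normal i j f -> normal i' j' f' -> i = i' -> j = j' -> f = f'.
Proof.
case=> [q|q|a q|a q] [q'|q'|a' q'|a' q'] Ei Ej; try by exfalso; lia.
- by congr (_ ^+ _); lia.
- by congr (_ * _ ^+ _); lia.
- by congr (_ ^+ _ * _ * _ ^+ _); lia.
- by congr (_ ^+ _ * _ * _ ^+ _); lia.
Qed.

Lemma normal0P i j f : normal i j f -> i = 0%N ->
  (exists2 q, j = (2 * q)%N & f = x ^+ q) \/
  (exists2 q, j = (2 * q + r)%N & f = y * x ^+ q).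
Proof. by case=> // q _; [left | right]; exists q. Qed.

Lemma normal_eqr i j j' f : j = j' -> normal i j f -> normal i j' f.
Proof. by move=> ->. Qed.

Section Reduction.
Variable N : P -> Prop.
Hypothesis N0 : N 0.
Hypothesis ND : forall p q, N p -> N q -> N (p + q).
Hypothesis NM : forall p q, N q -> N (p * q).

Lemma N_trans f g h : N (f - g) -> N (g - h) -> N (f - h).
Proof. by move=> fg gh; rewrite (_ : f - h = (f - g) + (g - h)); [exact: ND | ring]. Qed.

Lemma N_eq f g : f = g -> N (f - g).
Proof. by move=> ->; rewrite subrr. Qed.

Lemma N_mulr p q c : N q -> p = c * q -> N p.
Proof. by move=> Nq ->; apply: NM. Qed.

Lemma N_sym f g : N (f - g) -> N (g - f).
Proof. by move=> /(NM (-1)); rewrite mulN1r opprB. Qed.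

Hypothesis NA : N A.

(** The ideal [N] is arbitrary because the reduction serves for the ideal of [A] alone and for the
    ideals of [F1] and [phi1]. Modulo [A], [y ^+ 2] becomes [x ^+ r]. *)
Lemma normal_xy a b : exists f, normal 0 (2 * a + r * b) f /\ N (x ^+ a * y ^+ b - f).
Proof.
elim: b => [|b [f [nf Nf]]].
  by exists (x ^+ a); rewrite muln0 addn0 mulr1 subrr; split=> //; apply: Normal_even.
have step f' : normal 0 (2 * a + r * b.+1) f' -> N (y * f - f') ->
    exists f, normal 0 (2 * a + r * b.+1) f /\ N (x ^+ a * y ^+ b.+1 - f).
  move=> nf' Nf'; exists f'; split=> //; apply: N_trans Nf'.
  by rewrite exprS mulrCA -mulrBr; apply: NM.
have [[q Ej Ef]|[q Ej Ef]] := normal0P nf erefl; rewrite Ef in step.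
  apply: (step (y * x ^+ q)); last by rewrite subrr.
  by rewrite mulnS addnCA addnC Ej; apply: Normal_odd.
apply: (step (x ^+ (q + r))).
  by apply: normal_eqr (Normal_even (q + r)); lia.
rewrite exprD exprr; apply: (@N_mulr _ A (- x ^+ q)) => //; rewrite /gA; ring.
Qed.

Hypotheses (NB : N B) (NC : N C) (ND' : N D).

(** Only an odd power of t without s needs a relation: [B] turns [y * z] into [xe * w]. *)
Lemma normal_z i j f : normal i j f -> exists f', normal i.+1 j f' /\ N (z * f - f').
Proof.
case=> [q|q|a q|a q].
- exists (z ^+ 0 * z * x ^+ q); split; first exact: NormalS_even.
  by apply: N_eq; rewrite expr0; ring.
- exists (z ^+ 0 * w * x ^+ (q + e)); split.
    by apply: normal_eqr (NormalS_odd 0 (q + e)); lia.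
  by apply: (@N_mulr _ B (x ^+ q)) => //; rewrite expr0 exprD /gB; ring.
- exists (z ^+ a.+1 * z * x ^+ q); split; first exact: NormalS_even.
  by apply: N_eq; rewrite exprS; ring.
- exists (z ^+ a.+1 * w * x ^+ q); split; first exact: NormalS_odd.
  by apply: N_eq; rewrite exprS; ring.
Qed.

(** [C] turns [y * w] into [x * xe * z], and [D] turns [w * w] into [x * z * z]. *)
Lemma normal_w i j f : normal i j f -> exists f', normal i.+1 j.+1 f' /\ N (w * f - f').
Proof.
case=> [q|q|a q|a q].
- exists (z ^+ 0 * w * x ^+ q); split; first by apply: normal_eqr (NormalS_odd 0 q); lia.
  by apply: N_eq; rewrite expr0; ring.
- exists (z ^+ 0 * z * x ^+ (q + e).+1); split.
    by apply: normal_eqr (NormalS_even 0 (q + e).+1); lia.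
  by apply: (@N_mulr _ C (- x ^+ q)) => //; rewrite expr0 exprS exprD /gC; ring.
- exists (z ^+ a.+1 * w * x ^+ q); split; first by apply: normal_eqr (NormalS_odd a.+1 q); lia.
  by apply: N_eq; rewrite exprS; ring.
- exists (z ^+ a.+1 * z * x ^+ q.+1); split.
    by apply: normal_eqr (NormalS_even a.+1 q.+1); lia.
  by apply: (@N_mulr _ D (z ^+ a * x ^+ q)) => //; rewrite !exprS /gD; ring.
Qed.

Lemma normal_monomial a b c d : exists f, normal (c + d) (2 * a + r * b + d) f /\
  N (x ^+ a * y ^+ b * z ^+ c * w ^+ d - f).
Proof.
elim: d => [|d [f [nf Nf]]]; last first.
  have [f' [nf' Nf']] := normal_w nf; exists f'; rewrite (addnS c) (addnS (2 * a + r * b)); split=> //.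
  by apply: N_trans Nf'; rewrite exprS mulrCA -mulrBr; apply: NM.
rewrite mulr1 !addn0; elim: c => [|c [f [nf Nf]]].
  by rewrite mulr1; apply: normal_xy.
have [f' [nf' Nf']] := normal_z nf; exists f'; split=> //.
by apply: N_trans Nf'; rewrite exprS mulrCA -mulrBr; apply: NM.
Qed.
End Reduction.

(** One statement for [psi] and [phi], which agree on [x] and [y]. *)
Lemma key_eq (q s m m' : 'X_{1..4}) :
    let key (m : 'X_{1..4}) := (\sum_i sel (U_(ix) *+ 2) (U_(ix) *+ r) q s i *+ m i)%MM in
    key m = key m' ->
  forall j, (U_(ix)%MM j * (2 * m ix + r * m iy) + q j * m iz + s j * m iw =
    U_(ix)%MM j * (2 * m' ix + r * m' iy) + q j * m' iz + s j * m' iw)%N.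
Proof.
move=> key E j; have := congr1 (fun u : 'X_{1..4} => u j) E; rewrite /key !key_vars.
by rewrite !mulmnE; lia.
Qed.

(** The exponents of [z] and [w] can be read off from the image, so only [x] and [y] need a normal
    form. It follows that the ideal of [A] is prime. *)
Lemma phi_kernel f : phi f = 0 -> exists c, f = A * c.
Proof.
move=> f0; have key := mmap_monomial_key f0; move: f {f0} key => f.
pose N f := exists c, f = A * c.
have N0 : N 0 by exists 0; rewrite mulr0.
have ND p q : N p -> N q -> N (p + q).
  by move=> [c ->] [d ->]; exists (c + d); rewrite mulrDr.
have NM p q : N q -> N (p * q) by move=> [c ->]; exists (p * c); rewrite mulrCA.
have NA : N A by exists 1; rewrite mulr1.
apply: (monomial_kernel (N := N)) => // m m' /key_eq E.
move: (E ix) (E iz) (E iw); rewrite !mnm1E !eqxx !vars_neq.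
rewrite !mul0n !mul1n !add0n !addn0 => E1 E2 E3.
have [f1 [n1 N1]] := normal_xy N0 ND NM NA (m ix) (m iy).
have [f2 [n2 N2]] := normal_xy N0 ND NM NA (m' ix) (m' iy).
move: N2; rewrite -(normal_unique n1 n2 erefl E1) => /(N_sym NM) N2.
rewrite (mpolyX_vars m) (mpolyX_vars m') E2 E3 -!mulrBl mulrC; apply: (NM); rewrite mulrC.
by apply: (NM); apply: N_trans N1 N2.
Qed.

Notation F1 := (F1 x xe y z w).

Lemma psi_F1 (u : 'cV_4) : psi ((F1 *m u) ord0 ord0) = 0.
Proof.
rewrite !mxE sum_ord4 !mxE /= !rmorphD !rmorphM /= !psiF; ring.
Qed.

Section MxIdeal.
Variables (q : nat) (M : 'M[P]_(1, q)).

Definition mx_ideal (f : P) : Prop := exists u : 'cV_q, f = (M *m u) ord0 ord0.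

Lemma mx_ideal0 : mx_ideal 0.
Proof. by exists 0; rewrite mulmx0 mxE. Qed.
Lemma mx_idealD f g : mx_ideal f -> mx_ideal g -> mx_ideal (f + g).
Proof. by move=> [u ->] [v ->]; exists (u + v); rewrite mulmxDr [RHS]mxE. Qed.
Lemma mx_idealM (c f : P) : mx_ideal f -> mx_ideal (c * f).
Proof. by move=> [u ->]; exists (c *: u); rewrite -scalemxAr [RHS]mxE. Qed.
Lemma mx_ideal_gen j : mx_ideal (M ord0 j).
Proof. by exists (delta_mx j ord0); rewrite -colE mxE. Qed.
End MxIdeal.

Lemma F1_gens : (mx_ideal F1 A /\ mx_ideal F1 B) /\ (mx_ideal F1 C /\ mx_ideal F1 D).
Proof.
do !split; [have := mx_ideal_gen F1 o0 | have := mx_ideal_gen F1 o1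
  | have := mx_ideal_gen F1 o2 | have := mx_ideal_gen F1 o3]; by rewrite mxE.
Qed.

Lemma psi_kernel f : psi f = 0 -> mx_ideal F1 f.
Proof.
move=> f0; have key := mmap_monomial_key f0; move: f {f0} key => f.
have N0 := mx_ideal0 F1; have ND := @mx_idealD _ F1; have NM := @mx_idealM _ F1.
have [[NA NB] [NC NDD]] := F1_gens.
apply: (monomial_kernel (N := mx_ideal F1)) => // m m' /key_eq E.
move: (E ix) (E iz); rewrite !mnmDE !mnm1E !eqxx !vars_neq.
rewrite !mul0n !mul1n !add0n !addn0 => E1 E2.
have [f1 [n1 N1]] := normal_monomial N0 ND NM NA NB NC NDD
  (m ix) (m iy) (m iz) (m iw).
have [f2 [n2 N2]] := normal_monomial N0 ND NM NA NB NC NDD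
  (m' ix) (m' iy) (m' iz) (m' iw).
move: N2; have -> : f2 = f1 by apply: (normal_unique n2 n1); lia.
by rewrite (mpolyX_vars m) (mpolyX_vars m') => /(N_sym NM) N2; apply: N_trans N1 N2.
Qed.

(** * Regular pairs in P and acyclicity of F and G *)

Lemma killE : ((kill ix x = 0) * (kill ix y = y) * (kill ix z = z) * (kill ix w = w)) *
  ((kill iy x = x) * (kill iy y = 0) * (kill iy z = z) * (kill iy w = w)) *
  ((kill iz x = x) * (kill iz y = y) * (kill iz z = 0) * (kill iz w = w)) *
  ((kill iw x = x) * (kill iw y = y) * (kill iw z = z) * (kill iw w = 0)).
Proof. by rewrite !killX !eqxx !vars_neq. Qed.

Lemma var_neq0 i : 'X_i != 0 :> P.
Proof. by rewrite -msupp_eq0 msuppX. Qed.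

Lemma A_neq0 : A != 0.
Proof.
apply/eqP => /(congr1 (kill iy)) /eqP; apply/negP.
rewrite /gA rmorphB !rmorphM !rmorphXn /= rmorph0 !killE mul0r subr0.
by rewrite !mulf_neq0 ?expf_neq0 ?var_neq0.
Qed.

Lemma C_neq0 : C != 0.
Proof.
apply/eqP => /(congr1 (kill iw)) /eqP; apply/negP.
rewrite /gC rmorphB !rmorphM !rmorphXn /= rmorph0 !killE mulr0 subr0.
by rewrite !mulf_neq0 ?expf_neq0 ?var_neq0.
Qed.

Lemma regular_zw : regular_pair z w.
Proof. by apply: regular_pair_kill; rewrite killE var_neq0. Qed.
Lemma regular_yz : regular_pair y z.
Proof. by apply: regular_pair_kill; rewrite killE var_neq0. Qed.
Lemma regular_xy : regular_pair xe y.
Proof. by apply: regular_pair_kill; rewrite rmorphXn /= killE expf_neq0 ?var_neq0. Qed.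
Lemma regular_Dx : regular_pair D x.
Proof.
apply: regular_pair_kill; rewrite /gD rmorphB !rmorphM /= !killE !mul0r subr0.
by rewrite mulf_neq0 ?var_neq0.
Qed.

Lemma regular_CA : regular_pair C A.
Proof.
apply: (regular_pair_kernel A_neq0 phiA _ phi_kernel).
apply/eqP => /(congr1 (kill iw)) /eqP; apply/negP.
rewrite /gC rmorphB !rmorphM !rmorphXn /= !phiE rmorphB !rmorphM !rmorphXn /= rmorph0.
by rewrite !killE mulr0 subr0 !mulf_neq0 ?expf_neq0 ?var_neq0.
Qed.

Lemma regular_DA : regular_pair D A.
Proof.
apply: (regular_pair_kernel A_neq0 phiA _ phi_kernel).
apply/eqP => /(congr1 (kill iz)) /eqP; apply/negP.
rewrite /gD rmorphB !rmorphM /= !phiE rmorphB !rmorphM /= rmorph0.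
by rewrite !killE mulr0 subr0 !mulf_neq0 ?expf_neq0 ?var_neq0.
Qed.

Lemma D_dvd_xe v n' a : D * v = x ^+ n' * a -> exists b, v = x ^+ n' * b.
Proof.
elim: n' v a => [|n' IH] v a E; first by exists v; rewrite mul1r.
have [|c [-> /oppr_inj Ec]] := regular_Dx (a := v) (b := - (x ^+ n' * a)).
  by rewrite E exprS; ring.
have [b ->] := IH c a (esym Ec).
by exists b; rewrite exprS mulrA.
Qed.

(** Setting [y] to zero fixes [D], which is a nonzerodivisor modulo every power of [x]. *)
Lemma D_nzd v : (exists a b, D * v = xe * a + y * b) -> exists a b, v = xe * a + y * b.
Proof.
move=> [a [b /(congr1 (kill iy))]].
have killD : kill iy D = D by rewrite /gD rmorphB !rmorphM /= !killE.
rewrite (rmorphM _ D) /= killD rmorphD (rmorphM _ xe) (rmorphM _ y) rmorphXn /=.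
rewrite !killE mul0r addr0 => /D_dvd_xe [c Ec]; have [d Ed] := kill_sub iy v.
by exists c, d; rewrite -Ec -Ed addrC subrK.
Qed.

Lemma A_nzd v : (exists a b, A * v = z * a + w * b) -> exists a b, v = z * a + w * b.
Proof.
move=> [a [b /(congr1 (kill iw))/(congr1 (kill iz))]].
have killwA : kill iw A = A by rewrite /gA !(rmorphB, rmorphM, rmorphXn) /= !killE.
have killzA : kill iz A = A by rewrite /gA !(rmorphB, rmorphM, rmorphXn) /= !killE.
rewrite (rmorphM _ A) /= killwA rmorphD (rmorphM _ z) (rmorphM _ w) /=.
rewrite !killE mul0r addr0 (rmorphM _ A) (rmorphM _ z) /= killzA !killE mul0r => /eqP.
rewrite mulf_eq0 (negbTE A_neq0) /= => /eqP E.
have [c Ec] := kill_kernel E; have [d Ed] := kill_sub iw v.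
by exists c, d; rewrite -Ec -Ed addrC subrK.
Qed.

Lemma xe_neq0 : xe != 0.
Proof. by rewrite expf_neq0 ?var_neq0. Qed.

Lemma F_acyclic_family : acyclic F1 (F2 x xe y z w) (F3 xe y z w).
Proof.
apply: F_acyclic; [exact: xe_neq0 | exact: regular_zw | exact: regular_xy
  | exact: regular_yz | exact: regular_CA | exact: D_nzd | exact: C_neq0
  | exact: var_neq0].
Qed.

Lemma G_exact_family : exact_at (G1 x xe y z w) (G2 x xe y z w).
Proof. by apply: exact_G12; [exact: regular_DA | exact: A_neq0]. Qed.

(** * The ideal of relations of k[t^S] *)

Variables (n' m : nat).
Notation n := n'.+1.
Hypothesis n_m_coprime : coprime n m.
Hypothesis m_large : (2 * e + 2 <= m)%N.

(** The exponent leaves room for the factor [xe] or [y] that completes a monomial mapping to t^m. It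
    is positive by [m_large]. *)
Definition hh : P := x ^+ (m./2 - e).
Definition al : P := (~~ odd m)%:R.
Definition be : P := (odd m)%:R.
Notation ze := (z ^+ n').
Notation p := (gp xe y z hh al be ze).
Notation q := (gq x xe y w hh al be ze).
Notation a0 := (a0 x xe y z w hh al be ze).
Notation phi1 := (row_mx F1 a0).

Lemma tail_p : exists a b,
  hh * (al * xe + be * y) = x ^+ a * y ^+ b /\ (2 * a + r * b = m)%N.
Proof.
rewrite /al /be; have := odd_double_half m; case: odd => /= Em.
  exists (m./2 - e)%N, 1%N; split; [by rewrite /hh; ring | lia].
exists (m./2 - e + e)%N, 0%N; split; [by rewrite /hh exprD; ring | lia].
Qed.

Lemma tail_q : exists a b,
  hh * (al * y + be * x * xe) = x ^+ a * y ^+ b /\ (2 * a + r * b = m.+1)%N.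
Proof.
rewrite /al /be; have := odd_double_half m; case: odd => /= Em.
  exists (m./2 - e + e).+1, 0%N; split; [by rewrite /hh exprS exprD; ring | lia].
exists (m./2 - e)%N, 1%N; split; [by rewrite /hh; ring | lia].
Qed.

Lemma mx_ideal_F1_phi1 f : mx_ideal F1 f -> mx_ideal phi1 f.
Proof. by move=> [u ->]; exists (col_mx u 0); rewrite mul_row_col mulmx0 addr0. Qed.

Lemma phi1_gens : mx_ideal phi1 p /\ mx_ideal phi1 q.
Proof.
split.
  by have := mx_ideal_gen phi1 (rshift 4 b0); rewrite row_mxEr mxE.
by have := mx_ideal_gen phi1 (rshift 4 b1); rewrite row_mxEr mxE.
Qed.

Lemma normal_monomial_phi1 a b c d :
  exists f, normal (c + d) (2 * a + r * b + d) f /\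
    mx_ideal phi1 (x ^+ a * y ^+ b * z ^+ c * w ^+ d - f).
Proof.
have [[NA NB] [NC ND]] := F1_gens.
apply: (normal_monomial (mx_ideal0 phi1) (@mx_idealD _ phi1) (@mx_idealM _ phi1));
  exact: mx_ideal_F1_phi1.
Qed.

(** Modulo [p], s^n becomes t^m; modulo [q], t s^n becomes t^(m+1). This covers both parities of the
    exponent of t. *)
Lemma normal_reduce1 i j f : normal i j f -> (n <= i)%N ->
  exists f', normal (i - n) (j + m) f' /\ mx_ideal phi1 (f - f').
Proof.
have [Np Nq] := phi1_gens.
have [ap [bp [Ep Mp]]] := tail_p; have [aq [bq [Eq Mq]]] := tail_q.
case=> [s|s|a s|a s] //=; rewrite ltnS => /subnK <-; move: (a - n')%N => {a} a.
- have [f' [nf' Nf']] := normal_monomial_phi1 (s + ap) bp a 0.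
  exists f'; split.
    by move: nf'; rewrite addn0 subSS addnK; apply: normal_eqr; lia.
  apply: (N_trans (@mx_idealD _ phi1)) Nf'.
  rewrite (_ : _ - _ = z ^+ a * x ^+ s * p); first exact: mx_idealM.
  by rewrite /gp Ep !exprD; ring.
- have [f' [nf' Nf']] := normal_monomial_phi1 (s + aq) bq a 0.
  exists f'; split.
    by move: nf'; rewrite addn0 subSS addnK; apply: normal_eqr; lia.
  apply: (N_trans (@mx_idealD _ phi1)) Nf'.
  rewrite (_ : _ - _ = z ^+ a * x ^+ s * q); first exact: mx_idealM.
  by rewrite /gq Eq !exprD; ring.
Qed.

(** The preserved quantity is the degree of s^i t^j. *)
Lemma normal_reduce i j f : normal i j f -> exists i' j' f',
  [/\ (i' < n)%N, normal i' j' f', (n * j' + m * i' = n * j + m * i)%N &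
      mx_ideal phi1 (f - f')].
Proof.
elim/ltn_ind: i j f => i IH j f nf.
have [ni|ni] := ltnP i n.
  by exists i, j, f; split=> //; rewrite subrr; apply: mx_ideal0.
have [f1 [nf1 N1]] := normal_reduce1 nf ni.
have [|i' [j' [f' [i'n nf' E N']]]] := IH (i - n)%N _ _ _ nf1; first by lia.
exists i', j', f'; split=> //; last by apply: (N_trans (@mx_idealD _ phi1)) N1 N'.
by rewrite E -{2}(subnK ni); lia.
Qed.

Variable a : 4.-tuple nat.
Hypothesis a_vars : [/\ tnth a ix = (2 * n)%N, tnth a iy = (r * n)%N,
  tnth a iz = m & tnth a iw = (m + n)%N].

Lemma wdeg_vars u :
  wdeg a u = (n * (2 * u ix + r * u iy + u iw) + m * (u iz + u iw))%N.
Proof. rewrite /wdeg big_vars; case: a_vars => -> -> -> -> /=; lia. Qed.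

(** Since [m] is invertible modulo [n], the equation forces [i] and [i'] to be congruent modulo
    [n]. *)
Lemma degree_unique i j i' j' : (i < n)%N -> (i' < n)%N ->
  (n * j + m * i = n * j' + m * i')%N -> i = i' /\ j = j'.
Proof.
wlog le_ii : i j i' j' / (i <= i')%N.
  move=> H li li' E; have [/H|/ltnW/H] := leqP i i'; first exact.
  by move=> /(_ _ _ li' li (esym E)) [-> ->].
move=> li li' E.
have : (n %| m * (i' - i))%N.
  apply/dvdnP; exists (j - j')%N; rewrite mulnBr mulnBl; lia.
rewrite Gauss_dvdr // => /dvdn_leq; case: posnP => [|_ /(_ isT)]; last by lia.
move=> E0 _; have Ei : i = i' by lia.
by split=> //; move: E; rewrite Ei => /addIn /eqP; rewrite eqn_pmul2l // => /eqP.
Qed.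

Lemma semigroup_kernel f : semigroup_map a f = 0 -> mx_ideal phi1 f.
Proof.
move=> f0; apply: (monomial_kernel (key := wdeg a)).
- exact: mx_ideal0.
- exact: mx_idealD.
- exact: mx_idealM.
- move=> u u'; rewrite !wdeg_vars => E.
  have [f1 [n1 N1]] := normal_monomial_phi1 (u ix) (u iy) (u iz) (u iw).
  have [f2 [n2 N2]] := normal_monomial_phi1 (u' ix) (u' iy) (u' iz) (u' iw).
  have [i1 [j1 [g1 [li1 ng1 E1 Ng1]]]] := normal_reduce n1.
  have [i2 [j2 [g2 [li2 ng2 E2 Ng2]]]] := normal_reduce n2.
  rewrite (mpolyX_vars u) (mpolyX_vars u').
  have [Ei Ej] : i1 = i2 /\ j1 = j2 by apply: degree_unique; rewrite // E1 E2.
  have T := N_trans (@mx_idealD _ phi1).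
  apply: (T _ _ _ N1); apply: (T _ _ _ Ng1); rewrite (normal_unique ng1 ng2 Ei Ej).
  by apply: (T _ _ _ (N_sym (@mx_idealM _ phi1) Ng2)); apply: (N_sym (@mx_idealM _ phi1)).
by move=> c; rewrite -semigroup_map_coef f0 coef0.
Qed.

Lemma semigroup_map_phi1 (u : 'cV_(4 + 2)) :
  semigroup_map a ((phi1 *m u) ord0 ord0) = 0.
Proof.
have [ap [bp [Ep Mp]]] := tail_p; have [aq [bq [Eq Mq]]] := tail_q.
(* [T] and [Z] are the images of t and s, and [ZT] is the relation s^n = t^m. *)
pose T : {poly k} := 'X^n; pose Z : {poly k} := 'X^m.
have ZT : Z * Z ^+ n' = T ^+ m by rewrite -exprS -!exprM mulnC.
pose sm : {rmorphism P -> {poly k}} := mmap (@polyC k) (fun i => 'X^(tnth a i)).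
have [Ex Ey Ez Ew] : [/\ sm x = T ^+ 2, sm y = T * T ^+ e * T ^+ e,
    sm z = Z & sm w = Z * T].
  rewrite /sm /= !mmapX !mmap1U; case: a_vars => -> -> -> ->.
  by rewrite -!exprM -!exprD; split; congr ('X^_); lia.
rewrite -[semigroup_map a _]/(sm _); move: sm Ex Ey Ez Ew => sm Ex Ey Ez Ew.
have Exe : sm xe = T ^+ e * T ^+ e by rewrite rmorphXn /= Ex exprAC expr2.
have Tr b : (T * T ^+ e * T ^+ e) ^+ b = T ^+ (r * b).
  by rewrite exprM; congr (_ ^+ _); rewrite -exprS -exprD; congr (_ ^+ _); lia.
have Hp : sm (hh * (al * xe + be * y)) = T ^+ m.
  by rewrite Ep rmorphM !rmorphXn /= Ex Ey Tr -exprM -exprD Mp.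
have Hq : sm (hh * (al * y + be * x * xe)) = T ^+ m.+1.
  by rewrite Eq rmorphM !rmorphXn /= Ex Ey Tr -exprM -exprD Mq.
rewrite -[u]vsubmxK mul_row_col mxE !mxE sum_ord4 sum_ord2 !mxE /=.
have sA : sm A = 0 by rewrite /gA rmorphB !rmorphM /= Exe Ex Ey; ring.
have sB : sm B = 0 by rewrite /gB rmorphB !rmorphM /= Exe Ey Ez Ew; ring.
have sC : sm C = 0 by rewrite /gC rmorphB !rmorphM /= Exe Ex Ey Ez Ew; ring.
have sD : sm D = 0 by rewrite /gD rmorphB !rmorphM /= Ex Ez Ew; ring.
have sp : sm p = 0.
  by rewrite /gp rmorphB /= Hp rmorphM rmorphXn /= Ez ZT subrr.
have sq : sm q = 0.
  by rewrite /gq rmorphB /= Hq rmorphM rmorphXn /= Ew Ez mulrAC ZT exprSr subrr.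
rewrite !rmorphD (rmorphM _ A) (rmorphM _ B) (rmorphM _ C) (rmorphM _ D).
by rewrite (rmorphM _ p) (rmorphM _ q) /= sA sB sC sD sp sq !mul0r !addr0.
Qed.

(** * The mapping cone *)

Notation G1 := (G1 x xe y z w).
Notation phi2 := (block_mx (F2 x xe y z w) (a1 x hh al be ze) 0 G1).
Notation phi3 := (block_mx (F3 xe y z w) (a2 x hh al be ze) 0 (G2 x xe y z w)).

Lemma mul_proportional (R : comPzRingType) (c1 c2 g1 g2 u v : R) :
  c1 * g2 = c2 * g1 -> g1 * (c1 * u + c2 * v) = c1 * (g1 * u + g2 * v).
Proof. by move=> E; rewrite !mulrDr !mulrA E; ring. Qed.

(** This is the injectivity of multiplication by s^n - t^m from k[s, t] to B. Both q/p and w/z map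
    to t, so cancelling [psi p] in a domain turns a relation with coefficients [p], [q] into one
    with [z], [w], to which [G1_kernel] applies. *)
Lemma cone_kernel (v1 : 'cV_4) (v2 : 'cV_2) :
  F1 *m v1 + a0 *m v2 = 0 -> exists u : 'cV_4, v2 = G1 *m u.
Proof.
move=> /matrixP/(_ ord0 ord0); rewrite [LHS]mxE => E.
apply: (G1_kernel regular_zw A_nzd); apply: psi_kernel.
(* Setting t to zero leaves s^n, because [hh] maps to a positive power of t. *)
have psi_p : psi p != 0.
  apply/eqP => /(congr1 (kill ix)) /eqP; apply/negP.
  rewrite /gp rmorphB (rmorphM _ hh) (rmorphM _ z) !rmorphXn /= !psiE.
  rewrite rmorphB !rmorphM !rmorphXn /= !killE expr0n.
  have l0 : (m./2 - e == 0)%N = false by apply/negP => /eqP; lia.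
  by rewrite /= expr0n l0 mul0r subr0 rmorph0 mulf_neq0 ?expf_neq0 ?var_neq0.
apply: (mulfI psi_p); rewrite mulr0.
transitivity (psi z * psi ((F1 *m v1) ord0 ord0 + (a0 *m v2) ord0 ord0)); last first.
  by rewrite E mxE rmorph0 mulr0.
have zq : psi z * psi q = psi w * psi p.
  rewrite -!rmorphM; apply/eqP; rewrite -subr_eq0 -rmorphB /=.
  rewrite (_ : _ - _ = - hh * (al * B + be * C)); last by rewrite /gp /gq /gB /gC; ring.
  by rewrite rmorphM rmorphD (rmorphM _ al) (rmorphM _ be) /= !psiF !mulr0 addr0 mulr0.
set f1 := (F1 *m v1) ord0 ord0; have f1E : psi f1 = 0 := psi_F1 v1.
have -> : (a0 *m v2) ord0 ord0 = p * v2 b0 ord0 + q * v2 b1 ord0.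
  by rewrite mxE sum_ord2 !mxE.
rewrite (rmorphD _ f1) /= f1E add0r (rmorphD _ (p * _)) (rmorphD _ (z * v2 _ _)).
rewrite (rmorphM _ p) (rmorphM _ q) (rmorphM _ z) (rmorphM _ w) /=.
exact: mul_proportional zq.
Qed.

Lemma phi_acyclic : acyclic phi1 phi2 phi3.
Proof.
apply: cone_acyclic.
- exact: F_acyclic_family.
- exact: G_exact_family.
- by apply: G2_inj; [exact: A_neq0 | exact: var_neq0].
- exact: chain1.
- exact: chain2.
exact: cone_kernel.
Qed.

(** * Degrees and minimality *)

Hypothesis e_gt0 : (0 < e)%N.
Hypothesis n'_gt0 : (0 < n')%N.

Notation hpos := (hpos a).

Lemma hpos_x : hpos (2 * n)%N x.
Proof. by case: a_vars => E _ _ _; rewrite -E; apply: hposX; rewrite E; lia. Qed.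
Lemma hpos_y : hpos (r * n)%N y.
Proof. by case: a_vars => _ E _ _; rewrite -E; apply: hposX; rewrite E; lia. Qed.
Lemma hpos_z : hpos m z.
Proof. by case: a_vars => _ _ E _; rewrite -E; apply: hposX; rewrite E; lia. Qed.
Lemma hpos_w : hpos (m + n)%N w.
Proof. by case: a_vars => _ _ _ E; rewrite -E; apply: hposX; rewrite E; lia. Qed.
Lemma hpos_xe : hpos (2 * n * e)%N xe.
Proof. by rewrite PoszM; apply: hposXn => //; apply: hpos_x. Qed.
Lemma hpos_ze : hpos (m * n')%N ze.
Proof. by rewrite PoszM; apply: hposXn => //; apply: hpos_z. Qed.

Lemma hpos_hh : hpos (2 * n * (m./2 - e))%N hh.
Proof. by rewrite PoszM; apply: hposXn; [apply: hpos_x | lia]. Qed.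

(** The degree of [hh] depends on the parity of [m]. With a factor [al] or [be] it has a single
    formula, because zero is homogeneous of every degree. *)
Lemma hpos_al : hpos (n%:Z * m%:Z - 2 * n%:Z * e%:Z) (al * hh).
Proof.
apply: hpos_nat => m_even; apply: hpos_eq hpos_hh _.
have [d Eh] : exists d, m./2 = (e + d)%N by exists (m./2 - e)%N; lia.
have := odd_double_half m; rewrite (negbTE m_even) Eh addKn -muln2 => <-; lia.
Qed.

Lemma hpos_be : hpos (n%:Z * m%:Z - 2 * n%:Z * e%:Z - n%:Z) (be * hh).
Proof.
apply: hpos_nat => m_odd; apply: hpos_eq hpos_hh _.
have [d Eh] : exists d, m./2 = (e + d)%N by exists (m./2 - e)%N; lia.
have := odd_double_half m; rewrite m_odd Eh addKn -muln2 => <-; lia.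
Qed.

Lemma hpos_bex : hpos (n%:Z * m%:Z - 2 * n%:Z * e%:Z + n%:Z) (be * (x * hh)).
Proof. by rewrite mulrCA; apply: hpos_eq (hposM hpos_x hpos_be) _; lia. Qed.

(** The last two degrees here, the last four of [d2] and the last two of [d3] are those of [G]
    shifted by nm, the degree of s^n - t^m. *)
Definition d1 (i : 'I_(4 + 2)) : int := nth 0 [:: (2 * r * n)%N%:Z; (r * n + m)%N%:Z;
  (r * n + n + m)%N%:Z; (2 * (m + n))%N%:Z; (n * m)%N%:Z; (n * m + n)%N%:Z] i.
Definition d2 (i : 'I_(4 + 4)) : int := nth 0 [:: (2 * r * n + m)%N%:Z;
  (2 * r * n + m + n)%N%:Z; (2 * (m + n) + 2 * n * e)%N%:Z; (2 * (m + n) + r * n)%N%:Z;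
  (n * m + r * n)%N%:Z; (n * m + r * n + n)%N%:Z; (n * m + m + n)%N%:Z;
  (n * m + m + 2 * n)%N%:Z] i.
Definition d3 (i : 'I_(1 + 2)) : int := nth 0 [:: (2 * r * n + 2 * m + n)%N%:Z;
  (n * m + r * n + m + n)%N%:Z; (n * m + r * n + m + 2 * n)%N%:Z] i.

Ltac homogeneous := first
  [ apply: hposN; homogeneous
  | exact: hpos_al | exact: hpos_be | exact: hpos_bex | exact: hpos_x | exact: hpos_y
  | exact: hpos_z | exact: hpos_w | exact: hpos_xe | exact: hpos_ze
  | apply: hposM; homogeneous ].

Ltac entry := rewrite mxE /=; first [exact: hpos0 | eapply hpos_eq;
  [homogeneous | rewrite /formal_degree /d1 /d2 /d3 /=; lia]].

Lemma hpos_A : hpos (2 * r * n)%N A.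
Proof.
rewrite /gA; apply: hposD; last apply: hposN.
  by eapply hpos_eq; [homogeneous | lia].
by eapply hpos_eq; [homogeneous | lia].
Qed.
Lemma hpos_B : hpos (r * n + m)%N B.
Proof.
rewrite /gB; apply: hposD; last apply: hposN.
  by eapply hpos_eq; [homogeneous | lia].
by eapply hpos_eq; [homogeneous | lia].
Qed.
Lemma hpos_C : hpos (r * n + n + m)%N C.
Proof.
rewrite /gC; apply: hposD; last apply: hposN.
  by eapply hpos_eq; [homogeneous | lia].
by eapply hpos_eq; [homogeneous | lia].
Qed.
Lemma hpos_D : hpos (2 * (m + n))%N D.
Proof.
rewrite /gD; apply: hposD; last apply: hposN.
  by eapply hpos_eq; [homogeneous | lia].
by eapply hpos_eq; [homogeneous | lia].
Qed.
Lemma hpos_p : hpos (n * m)%N p.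
Proof.
rewrite /gp (_ : hh * _ = (al * hh) * xe + (be * hh) * y); last by ring.
apply: hposD; last apply: hposN; last apply: hposD.
- by eapply hpos_eq; [homogeneous | lia].
- by eapply hpos_eq; [homogeneous | lia].
by eapply hpos_eq; [homogeneous | lia].
Qed.
Lemma hpos_q : hpos (n * m + n)%N q.
Proof.
rewrite /gq (_ : hh * _ = (al * hh) * y + (be * hh) * (x * xe)); last by ring.
apply: hposD; last apply: hposN; last apply: hposD.
- by eapply hpos_eq; [homogeneous | lia].
- by eapply hpos_eq; [homogeneous | lia].
by eapply hpos_eq; [homogeneous | lia].
Qed.

Lemma hpos_phi1 : hpos_mx a (fun=> 0) d1 phi1.
Proof.
apply: hpos_row_mx; apply: forall_ord1.
  apply: forall_ord4; rewrite mxE /formal_degree subr0 /=.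
  - exact: hpos_A.
  - exact: hpos_B.
  - exact: hpos_C.
  - exact: hpos_D.
apply: forall_ord2; rewrite mxE /formal_degree subr0 /=.
  exact: hpos_p.
exact: hpos_q.
Qed.

Lemma hpos_phi2 : hpos_mx a d1 d2 phi2.
Proof.
apply: hpos_block_mx.
- by apply: forall_ord4; apply: forall_ord4; entry.
- by apply: forall_ord4; apply: forall_ord4; entry.
- by apply: forall_ord2; apply: forall_ord4; entry.
Qed.

Lemma hpos_phi3 : hpos_mx a d2 d3 phi3.
Proof.
apply: hpos_block_mx.
- by apply: forall_ord4; apply: forall_ord1; entry.
- by apply: forall_ord4; apply: forall_ord2; entry.
- by apply: forall_ord4; apply: forall_ord2; entry.
Qed.

(** The first inequality compares the last generator of [F] with the lowest degree among the last
    four of [d2]. The other two concern the third and the second column of [phi2] in the row of [p];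
    the first column and the row of [q] have smaller formal degrees. *)
Lemma family_degree_special (S : nat -> Prop) mult :
    (forall s, S s <-> exists u, wdeg a u = s) ->
    is_min_generators S a -> is_multiplicity S mult ->
    (2 * m + (4 * e + 3) * n < n * m + minn (r * n) (m + n))%N ->
    (2 * m + 2 * n + 2 * n * e < n * m + mult)%N ->
    (2 * r * n + m + n < n * m + mult)%N ->
  degree_special k S.
Proof.
move=> HS gens Hmult deg3 deg2 deg2'.
exists 4, a, mult, d1, d2, d3, phi1, phi2, phi3.
have [g1 m1] := hpos_mxP hpos_phi1; have [g2 m2] := hpos_mxP hpos_phi2.
have [g3 m3] := hpos_mxP hpos_phi3.
split; split=> //.
- split=> //; first exact: semigroup_map_is_semigroup_ring.
    move=> f; split=> [/semigroup_kernel // | [u ->]]; exact: semigroup_map_phi1.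
  exact: phi_acyclic.
- by apply: forall_ord4; rewrite /formal_degree /d2 /d3 /=; lia.
- apply: forall_ord2 => j; case: (split_ordP j) => {}j -> //;
    move: j; apply: forall_ord4 => //= _; rewrite /formal_degree /d1 /d2 /=; lia.
- by rewrite block_mxKdl block_mxKdl.
- by rewrite row_mxKl !block_mxKul; apply: F_acyclic_family.
Qed.
End Family.

(** * The semigroups *)

Local Close Scope ring_scope.
Local Open Scope nat_scope.

(** [generated] indexes coefficients by values and [wdeg] by positions; distinct entries let one
    pass between the two. *)
Lemma generated_wdeg n (a : n.-tuple nat) s :
  uniq a -> generated a s <-> exists u, wdeg a u = s.
Proof.
move=> a_uniq; split=> [[c ->]|[u <-]].
  exists [multinom c (tnth a i) | i < n]; rewrite /wdeg big_tuple.
  by apply: eq_bigr => i _; rewrite mnmE.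
exists (fun s => \sum_(i | tnth a i == s) u i); rewrite big_tuple /wdeg.
apply: eq_bigr => i _; rewrite (big_pred1 i) // => j /=.
by apply/eqP/eqP => [/(tuple_uniqP _ a_uniq)|->].
Qed.

Section FourGenerators.
Variables a b c d : nat.
Notation L := [:: a; b; c; d].

Lemma generated4P s : uniq L -> generated L s <->
  exists ca cb cc cd, s = ca * a + cb * b + cc * c + cd * d.
Proof.
move=> L_uniq; split=> [[f ->]|[ca [cb [cc [cd ->]]]]].
  by exists (f a), (f b), (f c), (f d); rewrite !big_cons big_nil addn0 !addnA.
exists (fun s => nth 0 [:: ca; cb; cc; cd] (index s L)).
rewrite !big_cons big_nil addn0 !addnA.
have idx i : i < 4 -> index (nth 0 L i) L = i by move=> i4; apply: index_uniq.
by rewrite (idx 0) // (idx 1) // (idx 2) // (idx 3).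
Qed.

Lemma generated_add s t : generated L s -> generated L t -> generated L (s + t).
Proof.
move=> [f ->] [g ->]; exists (fun x => f x + g x); rewrite -big_split /=.
by apply: eq_bigr => i _; rewrite mulnDl.
Qed.

Lemma generated_min_generators x :
  uniq L -> 0 \notin L -> min_generator (generated L) x -> x \in L.
Proof.
move=> Lu L0 [].
have [a0 b0 c0 d0] : [/\ a <> 0, b <> 0, c <> 0 & d <> 0].
  by move: L0; rewrite !inE; split; lia.
move=> /(generated4P _ Lu)[ca [cb [cc [cd Ex]]]] x0 irr.
have reduce t y : t \in L -> 0 < t -> generated L t -> generated L y -> x = t + y ->
    x \in L.
  move=> tL t0 Gt Gy Exy; case: (posnP y) => [y0|y0]; last by case: (irr _ _ Gt Gy t0 y0).
  by rewrite Exy y0 addn0.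
have G ca' cb' cc' cd' : generated L (ca' * a + cb' * b + cc' * c + cd' * d).
  by apply/(generated4P _ Lu); exists ca', cb', cc', cd'.
case: ca Ex => [|ca] Ex; last first.
  apply: (reduce a (ca * a + cb * b + cc * c + cd * d)) => //; last by lia.
  - by rewrite inE eqxx.
  - by lia.
  - by have := G 1 0 0 0; rewrite !mul0n !addn0 mul1n.
case: cb Ex => [|cb] Ex; last first.
  apply: (reduce b (cb * b + cc * c + cd * d)) => //; last by lia.
  - by rewrite !inE eqxx orbT.
  - by lia.
  - by have := G 0 1 0 0; rewrite !mul0n !addn0 mul1n.
  - exact: (G 0 cb cc cd).
case: cc Ex => [|cc] Ex; last first.
  apply: (reduce c (cc * c + cd * d)) => //; last by lia.
  - by rewrite !inE eqxx !orbT.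
  - by lia.
  - by have := G 0 0 1 0; rewrite !mul0n !addn0 mul1n.
  - exact: (G 0 0 cc cd).
case: cd Ex => [|cd] Ex; first by lia.
apply: (reduce d (cd * d)) => //.
- by rewrite !inE eqxx !orbT.
- by lia.
- by have := G 0 0 0 1; rewrite !mul0n mul1n.
exact: (G 0 0 0 cd).
Qed.

(** Closure under addition and 0 are automatic, so only a bound beyond which there are no gaps has
    to be supplied. *)
Lemma generated_numerical_semigroup N :
  (forall x, N <= x -> generated L x) -> numerical_semigroup (generated L).
Proof.
move=> large; split; [|exact: generated_add|by exists N].
by exists (fun=> 0); rewrite big1.
Qed.
End FourGenerators.

Section MultiplicitySix.
Variables (e b : nat).
Hypothesis e_gt0 : 0 < e.
Hypothesis b_large : 6 * e + 6 < b.
Hypothesis b_mod3 : b %% 3 <> 0.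
Notation r := (2 * e + 1).
Notation S := (generated [:: 6; 3 * r; b; b + 3]).

Lemma S6_gens_uniq : uniq [:: 6; 3 * r; b; b + 3].
Proof. rewrite /= !inE; lia. Qed.

Lemma S6_even q : S (6 * q).
Proof. by apply/(generated4P _ S6_gens_uniq); exists q, 0, 0, 0; lia. Qed.
Lemma S6_odd q : S (6 * q + 3 * r).
Proof. by apply/(generated4P _ S6_gens_uniq); exists q, 1, 0, 0; lia. Qed.
Lemma S6_one j : S (b + 3 * j).
Proof.
apply/(generated4P _ S6_gens_uniq); have := odd_double_half j; case: odd => /= Ej.
  by exists j./2, 0, 0, 1; lia.
by exists j./2, 0, 1, 0; lia.
Qed.
Lemma S6_two j : S (2 * b + 3 * j).
Proof.
have -> : 2 * b + 3 * j = (b + 3 * 0) + (b + 3 * j) by lia.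
by apply: generated_add; apply: S6_one.
Qed.

(** The cases are [cc + cd] equal to 0, 1, 2 or at least 3. The first splits by the parity of [cb],
    because [2 * (3 * r)] is a multiple of 6. *)
Lemma S6_cases x : S x -> [\/ exists q, x = 6 * q, exists q, x = 6 * q + 3 * r,
  exists j, x = b + 3 * j | (exists j, x = 2 * b + 3 * j) \/ 3 * b <= x].
Proof.
move=> /(generated4P _ S6_gens_uniq)[ca [cb [cc [cd ->]]]].
have [c0|] := posnP (cc + cd).
  have [-> ->] : cc = 0 /\ cd = 0 by lia.
  have := odd_double_half cb; case: odd => /= Ecb.
    by constructor 2; exists (ca + r * cb./2); rewrite -[in LHS]Ecb; lia.
  by constructor 1; exists (ca + r * cb./2); rewrite -[in LHS]Ecb; lia.
case E : (cc + cd) => [|[|[|s]]] // _.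
- constructor 3; exists (2 * ca + r * cb + cd).
  by have -> : cc = 1 - cd by [lia]; case: cd E => [|[|]] //; lia.
- constructor 4; left; exists (2 * ca + r * cb + cd).
  have -> : cc = 2 - cd by lia.
  by case: cd E => [|[|[|]]] //; lia.
constructor 4; right.
have -> : ca * 6 + cb * (3 * r) + cc * b + cd * (b + 3) =
  ca * 6 + cb * (3 * r) + (cc + cd) * b + cd * 3 by lia.
rewrite E; lia.
Qed.

Lemma S6_large x : 2 * b <= x -> S x.
Proof.
move=> xb; have x3 := divn_eq x 3; have x3lt := ltn_pmod x (isT : 0 < 3).
case E : (x %% 3 == 0).
  have := odd_double_half (x %/ 3); case: odd => /= Ex.
    have -> : x = 6 * ((x %/ 3)./2 - e) + 3 * r by lia.
    exact: S6_odd.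
  have -> : x = 6 * (x %/ 3)./2 by lia.
  exact: S6_even.
case E' : (x %% 3 == b %% 3).
  have -> : x = b + 3 * ((x - b) %/ 3) by lia.
  exact: S6_one.
have -> : x = 2 * b + 3 * ((x - 2 * b) %/ 3) by lia.
exact: S6_two.
Qed.

Lemma S6_genus : has_genus S (e + b - 1).
Proof.
(* Gaps by residue modulo 3: the odd multiples of 3 below [3 * r], the numbers below [b] congruent
   to [b], and those below [2 * b] congruent to [2 * b]. As 3 does not divide [b], the last two
   lists have [b - 1] elements together. *)
exists ([seq 6 * i + 3 | i <- iota 0 e] ++ [seq 3 * i + b %% 3 | i <- iota 0 (b %/ 3)]
  ++ [seq 3 * i + (2 * b) %% 3 | i <- iota 0 ((2 * b) %/ 3)]).
split.
- rewrite !cat_uniq !map_inj_uniq ?iota_uniq /=; try by move=> i j; lia.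
  rewrite has_cat negb_or andbT -andbA; apply/and3P; split.
  + by apply/hasPn => _ /mapP[i _ ->]; apply/negP => /mapP[j _]; lia.
  + by apply/hasPn => _ /mapP[i _ ->]; apply/negP => /mapP[j _]; lia.
  by apply/hasPn => _ /mapP[i _ ->]; apply/negP => /mapP[j _]; lia.
- move=> x; rewrite !mem_cat; split.
    case/or3P => /mapP[i]; rewrite mem_iota => /andP[_ ib] ->; split; try lia;
      by move=> /S6_cases [[q]|[q]|[q]|[[q]|]]; lia.
  move=> [x0 Sx].
  have x2b : x < 2 * b by rewrite ltnNge; apply/negP => /S6_large.
  case E : (x %% 3 == 0).
    have xodd : odd (x %/ 3).
      apply/negPn/negP => ev; apply: Sx; have -> : x = 6 * (x %/ 3)./2.
        by have := odd_double_half (x %/ 3); rewrite (negbTE ev); lia.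
      exact: S6_even.
    have xr : x < 3 * r.
      rewrite ltnNge; apply/negP => xr; apply: Sx.
      have -> : x = 6 * ((x %/ 3)./2 - e) + 3 * r.
        by have := odd_double_half (x %/ 3); rewrite xodd; lia.
      exact: S6_odd.
    apply/or3P; constructor 1; apply/mapP; exists (x %/ 3)./2; last first.
      by have := odd_double_half (x %/ 3); rewrite xodd; lia.
    by have := odd_double_half (x %/ 3); rewrite xodd mem_iota; lia.
  case E' : (x %% 3 == b %% 3).
    have xb : x < b.
      rewrite ltnNge; apply/negP => xb; apply: Sx.
      have -> : x = b + 3 * ((x - b) %/ 3) by lia.
      exact: S6_one.
    apply/or3P; constructor 2; apply/mapP; exists (x %/ 3); last by lia.
    by rewrite mem_iota; lia.
  apply/or3P; constructor 3; apply/mapP; exists (x %/ 3); last by lia.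
  by rewrite mem_iota; lia.
by rewrite !size_cat !size_map !size_iota; lia.
Qed.

Lemma S6_min_generators : is_min_generators S [tuple 6; 3 * r; b; b + 3].
Proof.
split; first by rewrite /=; lia.
move=> x; split; last first.
  by apply: generated_min_generators; [exact: S6_gens_uniq | rewrite !inE; lia].
have Sx : x \in [:: 6; 3 * r; b; b + 3] -> S x.
  rewrite !inE => /or4P[] /eqP ->.
  - exact: (S6_even 1).
  - exact: (S6_odd 0).
  - by have := S6_one 0; rewrite muln0 addn0.
  - exact: (S6_one 1).
move=> xL; split; first exact: Sx; first by move: xL; rewrite !inE; lia.
move=> y z /S6_cases Sy /S6_cases Sz y0 z0 E; move: xL; rewrite !inE.
case: Sy => [[q Ey]|[q Ey]|[q Ey]|[[q Ey]|Ey]];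
  case: Sz => [[q' Ez]|[q' Ez]|[q' Ez]|[[q' Ez]|Ez]] /or4P[] /eqP Ex; lia.
Qed.

Lemma S6_numerical_semigroup : numerical_semigroup S.
Proof. exact: generated_numerical_semigroup S6_large. Qed.

Lemma S6_multiplicity : is_multiplicity S 6.
Proof.
split=> //; first exact: (S6_even 1).
by move=> x /S6_cases [[q ->]|[q ->]|[q ->]|[[q ->]|]]; lia.
Qed.

(** Here n = 3 and m = [b]; [b_large] is exactly the degree inequality for the third map. *)
Lemma S6_degree_special (k : fieldType) : e <= 2 -> degree_special k S.
Proof.
move=> e2; apply: (@family_degree_special k o0 o1 o2 o3 _ e 2 b _ _
  [tuple 6; 3 * r; b; b + 3] _ _ _ S 6 _ S6_min_generators S6_multiplicity) => //; try lia.
- by rewrite prime_coprime //; apply/negP => /eqP; lia.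
- by split; rewrite /tnth /=; lia.
- by move=> s; apply: generated_wdeg S6_gens_uniq.
Qed.
End MultiplicitySix.

Section MultiplicityEight.
Notation S := (generated [:: 8; 10; 13; 15]).

Lemma S8P x : S x <-> exists ca cb cc cd, x = ca * 8 + cb * 10 + cc * 13 + cd * 15.
Proof. exact: generated4P. Qed.

Lemma S8_large x : 28 <= x -> S x.
Proof.
move=> x28; apply/S8P; pose q := (x - 28) %/ 8.
have := ltn_pmod (x - 28) (isT : 0 < 8); have := divn_eq (x - 28) 8; rewrite -/q.
case: ((x - 28) %% 8) => [|[|[|[|[|[|[|[|]]]]]]]] // Ex _.
- by exists q, 0, 1, 1; lia.
- by exists q.+2, 0, 1, 0; lia.
- by exists q, 0, 0, 2; lia.
- by exists q.+2, 0, 0, 1; lia.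
- by exists (q + 4), 0, 0, 0; lia.
- by exists q.+1, 1, 0, 1; lia.
- by exists (q + 3), 1, 0, 0; lia.
- by exists q, 2, 0, 1; lia.
Qed.

Lemma S8_genus : has_genus S 15.
Proof.
exists [:: 1; 2; 3; 4; 5; 6; 7; 9; 11; 12; 14; 17; 19; 22; 27]; split=> // x.
split=> [xgap|[x0 nSx]].
  split; first by move: xgap; rewrite !inE; lia.
  by move=> /S8P [ca [cb [cc [cd]]]]; move: xgap; rewrite !inE; lia.
have x28 : x < 28 by rewrite ltnNge; apply/negP => /S8_large.
have gen c0 c1 c2 c3 : x <> c0 * 8 + c1 * 10 + c2 * 13 + c3 * 15.
  by move=> E; apply: nSx; apply/S8P; exists c0, c1, c2, c3.
(* These are the twelve nonzero elements below 28. *)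
move: (gen 1 0 0 0) (gen 0 1 0 0) (gen 0 0 1 0) (gen 0 0 0 1) (gen 2 0 0 0)
  (gen 1 1 0 0) (gen 0 2 0 0) (gen 1 0 1 0) (gen 1 0 0 1) (gen 3 0 0 0)
  (gen 0 1 0 1) (gen 0 0 2 0).
rewrite !inE; lia.
Qed.

Lemma S8_min_generators : is_min_generators S [tuple 8; 10; 13; 15].
Proof.
split=> // x; split; last exact: generated_min_generators.
have S8 y : S y -> 0 < y -> 8 <= y by move=> /S8P [ca [cb [cc [cd]]]]; lia.
rewrite !inE => xL; split; [|lia|].
  apply/S8P; case/or4P: xL => /eqP ->.
  - by exists 1, 0, 0, 0.
  - by exists 0, 1, 0, 0.
  - by exists 0, 0, 1, 0.
  - by exists 0, 0, 0, 1.
by move=> y z /S8 Sy /S8 Sz /Sy y8 /Sz z8; lia.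
Qed.

Lemma S8_multiplicity : is_multiplicity S 8.
Proof.
split=> //; first by apply/S8P; exists 1, 0, 0, 0.
by move=> x /S8P [ca [cb [cc [cd]]]]; lia.
Qed.
End MultiplicityEight.

Theorem theorem3p1 (k : fieldType) :
  [/\ (forall g : nat, 13 <= g -> g %% 3 <> 0 ->
         let S := generated [:: 6; 9; g; g + 3] in
         [/\ numerical_semigroup S, degree_special k S & has_genus S g]),
      (forall g : nat, 21 <= g -> g %% 3 = 0 ->
         let S := generated [:: 6; 15; g - 1; g + 2] in
         [/\ numerical_semigroup S, degree_special k S & has_genus S g]) &
      (let S := generated [:: 8; 10; 13; 15] in
       [/\ numerical_semigroup S, degree_special k S & has_genus S 15])].
Proof.
split.
- move=> g g13 g3 S; have g_large : 6 * 1 + 6 < g by lia.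
  split.
  + exact: (@S6_numerical_semigroup 1).
  + exact: (@S6_degree_special 1).
  by have := @S6_genus 1 g isT g_large g3; rewrite add1n subn1.
- move=> g g21 g3; have -> : g + 2 = (g - 1) + 3 by lia.
  move=> S; have g_large : 6 * 2 + 6 < g - 1 by lia.
  have g3' : (g - 1) %% 3 <> 0 by lia.
  split.
  + exact: (@S6_numerical_semigroup 2).
  + exact: (@S6_degree_special 2).
  by have := @S6_genus 2 (g - 1) isT g_large g3'; rewrite (_ : 2 + (g - 1) - 1 = g) //; lia.
move=> S; split.
- exact: generated_numerical_semigroup S8_large.
(* With n = 5, m = 8 and r = 3, the variables x, y, z, w have degrees 10, 15, 8, 13. *)
- apply: (@family_degree_special k o1 o3 o0 o2 _ 1 4 8 _ _
    [tuple 8; 10; 13; 15] _ _ _ S 8 _ S8_min_generators S8_multiplicity) => //.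
  by move=> s; apply: generated_wdeg.
exact: S8_genus.
Qed.
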